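(* Let $d>1$ and let $\mathcal F_m(M)$ be a one-parameter exponential family with mean parameters in $(0,M]$, whose log-partition function $b$ is twice differentiable with continuous second derivative $b''>0$ on $\Theta$, and whose variance function $V$ satisfies, for some $C_L>0$, $|V(\mu)-V(\mu')|\le C_L|\mu-\mu'|$ for all $\mu,\mu'\in(0,M]$. Then there is a constant $C>0$, depending only on $d$, $C_L$ and $M$, such that for every $K\ge2$, every $T\ge2$, and every $K$-armed bandit problem whose reward distributions all belong to the (known) family $\mathcal F_m(M)$, the algorithm General-Exp-KL-MS with $L(k)=k/d$ satisfies $$\mathrm{Reg}(T)\le C\sqrt{V(\mu_{\max})\,K\,T\ln K}+C\,K\ln T.$$
   Context: Exponential family: given a base measure $m$ on $\mathbb R$, $\{p_\theta(dx)=m(dx)\exp(x\theta-b(\theta)):\theta\in\Theta\}$, where $\Theta\subset\mathbb R$ is an interval and $b(\theta)=\ln\int_{\mathbb R}e^{x\theta}m(dx)$. Members are determined by their mean $b'(\theta)$. The variance function $V(\mu)$ is the variance of the member with mean $\mu$. $\mathrm{KL}(\mu,\mu')$ denotes the Kullback–Leibler divergence $\mathbb E_{X\sim\nu}[\ln\frac{d\nu}{d\nu'}(X)]$ between the members $\nu,\nu'$ with means $\mu,\mu'$. Bandit: each arm $a\in[K]=\{1,\dots,K\}$ has reward distribution $\nu_a$ in the family with mean $\mu_a$; $\mu_{\max}=\max_a\mu_a$. In round $t=1,\dots,T$ the agent picks $I_t\in[K]$ (based on the past and internal randomness) and receives $r_t\sim\nu_{I_t}$, independent of the past given $I_t$.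 $N_{t,a}=\sum_{i\le t}\mathbf 1\{I_i=a\}$, $\hat\mu_{t,a}=\frac1{N_{t,a}}\sum_{i\le t}r_i\mathbf 1\{I_i=a\}$, $\hat\mu_{t,\max}=\max_a\hat\mu_{t,a}$. It is assumed that empirical means are means of members of the exponential family. Regret: $\mathrm{Reg}(T)=\mathbb E\big[\sum_{t=1}^T(\mu_{\max}-\mu_{I_t})\big]$. General-Exp-KL-MS with inverse temperature function $L$: in rounds $t\le K$ pull $I_t=t$; in each round $t>K$ pull $I_t=a$ with probability $p_{t,a}=\exp\!\big(-L(N_{t-1,a})\,\mathrm{KL}(\hat\mu_{t-1,a},\hat\mu_{t-1,\max})\big)/M_t$, where $M_t$ normalizes the probabilities to sum to $1$. *)

(* Defs.v *)
From HB Require Import structures.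
From mathcomp Require Import all_boot all_order all_algebra.
From mathcomp Require Import all_classical all_reals all_analysis.

Set Implicit Arguments.
Unset Strict Implicit.
Unset Printing Implicit Defensive.
Import Order.TTheory GRing.Theory Num.Theory.
Import numFieldNormedType.Exports.

Local Open Scope classical_set_scope.
Local Open Scope ring_scope.

Section real_laws.
Variable R : realType.

Definition law : Type := probability (measurableTypeR R) R.
Implicit Types P Q : law.

Definition mean P : R := fine (expectation P (fun x => x)).

Definition var P : R := fine (variance P (fun x => x)).

(* E_{X ~ P} [ln (dP/dQ)(X)], with the Radon-Nikodym derivative of the
   library; it is only meant for P absolutely continuous with respect to Q,
   which always holds between members of one exponential family. *)
Definition KL P Q : R :=
  \int[P]_x ln (fine (Radon_Nikodym (charge_of_finite_measure P) Q x)).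

End real_laws.

Section exponential_families.
Variables (R : realType) (m : {measure set (measurableTypeR R) -> \bar R}).
Variable Theta : set R.

Definition partition_function (theta : R) : \bar R :=
  (\int[m]_x (expR (x * theta))%:E)%E.

Definition log_partition (theta : R) : R := ln (fine (partition_function theta)).

Definition expfam : set (law R) :=
  [set P | exists2 theta, Theta theta &
     forall A, measurable A ->
       P A = (\int[m]_(x in A) (expR (x * theta - log_partition theta))%:E)%E].

(* The derivative is taken within A: it is one-sided at an endpoint
   belonging to A. *)
Definition derivative_within (A : set R) (f f' : R -> R) : Prop :=
  forall x, A x ->
    (f y - f x) / (y - x) @[y --> within A x^'] --> f' x.

Definition regular_expfam : Prop :=
  [/\ is_interval Theta,
      (forall theta, Theta theta -> (0 < partition_function theta < +oo)%E)
    & exists b' b'' : R -> R,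
        [/\ derivative_within Theta log_partition b',
            derivative_within Theta b' b'',
            {within Theta, continuous b''}
          & forall theta, Theta theta -> 0 < b'' theta]].

End exponential_families.

Section mean_parametrization.
Variables (R : realType) (F : set (law R)).

Definition means : set R := [set mean P | P in F].

(* The member of F with mean mu; the Dirac mass is a junk value, used when
   mu is not in [means F]. *)
Definition member (mu : R) : law R :=
  xget (dirac (0 : measurableTypeR R) : law R) [set P | F P /\ mean P = mu].

Definition variance_function (mu : R) : R := var (member mu).

Definition KLm (mu mu' : R) : R := KL (member mu) (member mu').

(* F_m(M), when F is the family with base measure m: the members whose mean is
   in (0, M]; F itself may have other members. *)
Definition mean_bounded (M : R) : set (law R) :=
  [set P | F P /\ 0 < mean P <= M].

End mean_parametrization.

Section bandits.
Variables (R : realType) (K : nat).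

(* Past arms and rewards, oldest first; arms are numbered from 0. *)
Definition past : Type := seq ('I_K * R).

Definition pulls (h : past) (a : 'I_K) : nat := count (fun x => x.1 == a) h.

Definition emp_mean (h : past) (a : 'I_K) : R :=
  (\sum_(x <- h | x.1 == a) x.2) / (pulls h a)%:R.

Definition emp_max (h : past) : R := sup (range (emp_mean h)).

(* [pi h a] is the probability of pulling a in the round following h. *)
Definition policy : Type := past -> 'I_K -> R.

Definition general_exp_kl_ms (F : set (law R)) (L : nat -> R) : policy :=
  fun h a =>
    if (size h < K)%N then ((a : nat) == size h)%:R
    else
      let w b := expR (- (L (pulls h b) * KLm F (emp_mean h b) (emp_max h))) in
      w a / \sum_(b < K) w b.

Variables (d : measure_display) (Omega : measurableType d).
Variable P : probability Omega R.
Variable nu : 'I_K -> law R.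
Variable T : nat.

(* I t and r t are the arm and the reward of round t; only the rounds
   1, ..., T matter. *)
Variables (I : nat -> Omega -> 'I_K) (r : nat -> Omega -> R).

Definition history (t : nat) (w : Omega) : past :=
  [seq (I s w, r s w) | s <- iota 1 t].

(* The sigma-algebra generated by the first t rounds. *)
Definition history_events (t : nat) : set (set Omega) :=
  <<s [set A | exists2 s, (1 <= s <= t)%N &
        (exists a, A = I s @^-1` [set a]) \/
        (exists2 B : set (measurableTypeR R), measurable B & A = r s @^-1` B)] >>.

(* [run_arm]: the conditional law of the arm of round t+1, given the first t
   rounds, is prescribed by pi.
   [run_reward]: given the first t rounds and the event that arm a is pulled
   in round t+1, the reward of that round has law nu a. *)
Record bandit_run (pi : policy) : Prop := BanditRun {
  run_arm_measurable : forall t a, (1 <= t <= T)%N ->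
    measurable (I t @^-1` [set a]);
  run_reward_measurable : forall t, (1 <= t <= T)%N ->
    measurable_fun setT (r t : Omega -> measurableTypeR R);
  run_arm : forall t a H, (t < T)%N -> history_events t H ->
    P (H `&` I t.+1 @^-1` [set a]) = (\int[P]_(w in H) (pi (history t w) a)%:E)%E;
  run_reward : forall t a H (B : set (measurableTypeR R)), (t < T)%N ->
    history_events t H -> measurable B ->
    P (H `&` I t.+1 @^-1` [set a] `&` r t.+1 @^-1` B) =
    (P (H `&` I t.+1 @^-1` [set a]) * nu a B)%E
}.

(* Almost surely, the empirical mean of every arm pulled so far is the mean of
   a member of F. *)
Definition emp_means_in (F : set (law R)) : Prop :=
  {ae P, forall w, forall t a, (1 <= t <= T)%N ->
     (0 < pulls (history t w) a)%N -> means F (emp_mean (history t w) a)}.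

Definition mu_max : R := sup (range (fun a => mean (nu a))).

Definition regret : \bar R :=
  expectation P (fun w => \sum_(1 <= t < T.+1) (mu_max - mean (nu (I t w)))).

End bandits.

(* Main.v *)
(** Fix an arm [a] with gap [D > 0], and write [kl x y] for the divergence
    between the members with means [x] and [y]. It is a Bregman divergence of
    the log-partition function, so it is superadditive along monotone triples of
    means; and since the variance function is at most [V mu_max + C_L * D]
    between [mu_a] and [mu_max], [kl x y] is at least [(y - x)^2] over twice
    that bound there. With [x2 = mu_a + D/3] and [y0 = mu_a + 2D/3], all of
    [kl x2 mu_a], [kl x2 y0], [kl y0 mu_max] are at least
    [kap = D^2 / (18 (V mu_max + C_L D))].

    A pull of [a] falls in one of four cases. Either [a] has been pulled at most
    [u] times; or its empirical mean exceeds [x2], which by Chernoff happens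
    about [1/kap] times; or the empirical mean of [a] is below [x2] and the
    largest one above [y0], and then the sampling weight is at most
    [exp (- u kap / d)]; or all empirical means are below [y0]. In the last
    case, if the best arm has been pulled [k] times and has empirical mean [x],
    then [a] is at most [exp (k kl x y0 / d)] times as likely as the best arm.
    As [kl x y0 >= c] has probability at most [exp (- k (c + kap))] and [d > 1],
    these terms add up to a geometric series, of order [1/kap] in total.

    Hence [a] is pulled [O (1 + ln (max (T kap) e) / kap)] times in expectation;
    this is used for the gaps above [sqrt (V mu_max * K * ln K / T)], the others
    costing at most [T] times this threshold. *)

Require Import Defs.
From HB Require Import structures.
From mathcomp Require Import all_boot all_order all_algebra.
From mathcomp Require Import all_classical all_reals all_analysis.
From mathcomp Require Import measurable_realfun.
From mathcomp Require Import ring lra.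
Import Order.TTheory GRing.Theory Num.Theory.
Import numFieldNormedType.Exports.
Local Open Scope classical_set_scope.
Local Open Scope ring_scope.
Set Implicit Arguments.
Unset Strict Implicit.
Unset Printing Implicit Defensive.

(** * Exponential families *)

Section density.
Local Open Scope ereal_scope.
Context d (T : measurableType d) (R : realType).
Variables (mu nu : {measure set T -> \bar R}) (g : T -> R).
Hypotheses (mg : measurable_fun setT g) (g0 : forall x, (0 <= g x)%R).
Hypothesis nuE : forall A, measurable A -> nu A = \int[mu]_(x in A) (g x)%:E.

Import HBNNSimple.

Lemma nnsfun_integral_density (h : {nnsfun T >-> R}) :
  \int[nu]_x (h x)%:E = \int[mu]_x ((h x)%:E * (g x)%:E).
Proof.
transitivity (\int[nu]_x
   (\sum_(y \in range h) (y * \1_(h @^-1` [set y]) x)%:E)).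
  by apply: eq_integral => t tE; rewrite /= fimfunE -fsumEFin.
have mi r : measurable_fun [set: T] (fun x => (r * \1_(h @^-1` [set r]) x)%:E).
  by apply/measurable_EFinP; exact: measurable_funM.
rewrite ge0_integral_fsum//; last by move=> r x _; exact: nnfun_muleindic_ge0.
transitivity (\int[mu]_x (\sum_(y \in range h)
    (y * \1_(h @^-1` [set y]) x)%:E * (g x)%:E)); last first.
  under [RHS]eq_integral => x xE.
    rewrite (fimfunE h x) -fsumEFin// ge0_mule_fsuml; last first.
      by move=> y; exact: nnfun_muleindic_ge0.
    over.
  by [].
rewrite ge0_integral_fsum//; last 2 first.
- by move=> y; apply: emeasurable_funM => //; exact/measurable_EFinP.
- by move=> m y _; apply: mule_ge0; [exact: nnfun_muleindic_ge0|rewrite lee_fin].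
apply: eq_fsbigr => r rh.
have mr : measurable (h @^-1` [set r]) by [].
have r0 : (0 <= r)%R by move: rh; rewrite inE => -[t _ <-].
under eq_integral do rewrite EFinM.
rewrite integralZl_indic_nnsfun// integral_indic// setIT nuE//.
rewrite integral_mkcond.
under [RHS]eq_integral do rewrite EFinM -muleA.
rewrite ge0_integralZl//.
- congr (_ * _); apply: eq_integral => x _.
  by rewrite epatch_indic muleC.
- by apply: emeasurable_funM; [exact/measurable_EFinP|exact/measurable_EFinP].
- by move=> x _; rewrite mule_ge0 ?lee_fin.
Qed.

(** Monotone convergence along simple functions reduces this to indicators. The measure [mu] is
    arbitrary, in particular possibly not sigma-finite, so everything is done with the explicit
    density [g]. *)
Lemma ge0_integral_density (f : T -> \bar R) :
  measurable_fun setT f -> (forall x, 0 <= f x) ->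
  \int[nu]_x f x = \int[mu]_x (f x * (g x)%:E).
Proof.
move=> mf f0; pose h := nnsfun_approx measurableT mf.
have hf x : (EFin \o h^~ x) n @[n --> \oo] --> f x by exact: cvg_nnsfun_approx.
have ndh x a b : (a <= b)%N -> (h a x <= h b x)%R.
  by move=> ab; exact/lefP/nd_nnsfun_approx.
transitivity (limn (fun n => \int[nu]_x (h n x)%:E)).
  rewrite -monotone_convergence//.
  - by apply: eq_integral => x _; apply/esym/cvg_lim => //; exact: hf.
  - by move=> n; exact/measurable_EFinP.
  - by move=> n x _; rewrite lee_fin.
  - by move=> x _ a b ab; rewrite lee_fin; exact: ndh.
transitivity (limn (fun n => \int[mu]_x ((h n x)%:E * (g x)%:E))).
  by congr (limn _); apply/funext => n; exact: nnsfun_integral_density.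
rewrite -monotone_convergence//.
- apply: eq_integral => x _; apply/cvg_lim => //.
  by apply: cvgeZr => //; exact: hf.
- by move=> n; apply: emeasurable_funM; exact/measurable_EFinP.
- by move=> n x _; rewrite mule_ge0 ?lee_fin.
- by move=> x _ a b ab; rewrite lee_wpmul2r ?lee_fin//; exact: ndh.
Qed.

End density.

(** * Monotone limits with finite integrals *)

Section limits_of_integrals.
Local Open Scope ereal_scope.
Context d (T : measurableType d) (R : realType).

(** Monotone convergence for the nonnegative increasing differences [q 0 - q n]; the finite limit of
    their integrals is what makes [y] integrable. *)
Lemma nonincreasing_cvg_integral (mu : {measure set T -> \bar R})
    (q : nat -> T -> R) (y : T -> R) (a : nat -> R) (L : R) :
  (forall n, mu.-integrable setT (EFin \o q n)) ->
  (forall n x, (q n.+1 x <= q n x)%R) ->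
  measurable_fun setT y ->
  (forall x, q n x @[n --> \oo] --> y x) ->
  (forall n, \int[mu]_x (q n x)%:E = (a n)%:E) ->
  a n @[n --> \oo] --> L ->
  mu.-integrable setT (EFin \o y) /\ \int[mu]_x (y x)%:E = L%:E.
Proof.
move=> qi qS my qy qa aL.
have qni m n x : (m <= n)%N -> (q n x <= q m x)%R.
  by move=> mn; exact: ((nonincreasing_seqP (q^~ x)).1 (qS^~ x) m n mn).
have mq n : measurable_fun setT (q n) by apply/measurable_EFinP; have /integrableP[] := qi n.
pose g n x : \bar R := (q 0%N x - q n x)%:E.
pose z x : \bar R := (q 0%N x - y x)%:E.
have gz x : g n x @[n --> \oo] --> z x.
  apply: cvg_EFin; first by apply: nearW.
  by apply: cvgB; [exact: cvg_cst|exact: qy].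
have yq x : (y x <= q 0%N x)%R.
  rewrite -(cvg_lim _ (qy x))//; apply: limr_le; first exact: cvgP (qy x).
  by apply: nearW => n; exact: qni.
have ig n : \int[mu]_x g n x = (a 0%N - a n)%:E.
  by rewrite (integralB_EFin measurableT (qi 0%N) (qi n)) !qa.
have iz : \int[mu]_x z x = (a 0%N - L)%:E.
  have h1 : (\int[mu]_x g n x) @[n --> \oo] --> \int[mu]_x (fun x => limn (g^~ x)) x.
    apply: cvg_monotone_convergence => //.
    - by move=> n; apply/measurable_EFinP; exact: measurable_funB.
    - by move=> n x _; rewrite lee_fin subr_ge0 qni.
    - by move=> x _ m n mn; rewrite lee_fin lerB// qni.
  have h2 : (\int[mu]_x g n x) @[n --> \oo] --> (a 0%N - L)%:E.
    under eq_fun do rewrite ig.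
    by apply: cvg_EFin; [exact: nearW|apply: cvgB => //; exact: cvg_cst].
  rewrite -(cvg_unique _ h1 h2)//; apply: eq_integral => x _.
  by apply/esym/cvg_lim => //; exact: gz.
have zi : mu.-integrable setT z.
  apply/integrableP; split; first by apply/measurable_EFinP; exact: measurable_funB.
  under eq_integral => x _ do rewrite gee0_abs ?lee_fin ?subr_ge0//.
  by rewrite iz ltry.
have yE : EFin \o y = (EFin \o q 0%N) \- z.
  by apply/funext => x; rewrite /= /z -EFinB; congr EFin; rewrite opprB addrC subrK.
split; first by rewrite yE; exact: integrableB.
rewrite (_ : (fun x => (y x)%:E) = EFin \o y)// yE integralB//.
by rewrite iz (qa 0%N) -EFinB opprB addrC subrK.
Qed.

End limits_of_integrals.

(* Along steps [h / 2^n] the difference quotients of [expR] are monotone in [n],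
   by elementary algebra. This gives the integral limits below, for the mean
   even at an endpoint of the parameter interval. *)
Section dyadic_increments.
Variable R : realType.
Implicit Types y : R.

Definition expR_incr n y : R := 2 ^+ n * (expR (y / 2 ^+ n) - 1).

Definition expR_incr2 n y : R :=
  4 ^+ n * (expR (y / 2 ^+ n) + expR (- y / 2 ^+ n) - 2).

Lemma cvg_div_2Xn y : y / 2 ^+ n @[n --> \oo] --> (0 : R).
Proof.
rewrite -[X in _ --> X](mulr0 y); apply: cvgM; first exact: cvg_cst.
under eq_fun do rewrite -exprVn.
by apply: cvg_expr; rewrite ger0_norm// invf_lt1// ltr1n.
Qed.

(** With [E = expR (y / 2 ^+ n.+1)], the drop from [n] to [n.+1] is [2 ^+ n * (E - 1) ^+ 2]. *)
Lemma expR_incrS n y : expR_incr n.+1 y <= expR_incr n y.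
Proof.
rewrite /expR_incr -subr_ge0.
have -> : y / 2 ^+ n = y / 2 ^+ n.+1 + y / 2 ^+ n.+1.
  by rewrite exprS; field; rewrite expf_neq0.
rewrite expRD exprS; set E := expR _.
have -> : 2 ^+ n * (E * E - 1) - 2 * 2 ^+ n * (E - 1) = 2 ^+ n * (E - 1) ^+ 2.
  ring.
by rewrite mulr_ge0 ?sqr_ge0// exprn_ge0.
Qed.

(** Squeeze between [u n] and [u n / (1 - u n)], from [1 + v <= expR v <= 1 / (1 - v)] for [v < 1];
    the hypothesis forces [u n] to tend to 0. *)
Lemma cvg_expR_sub1 (u : nat -> R) (L : R) : 2 ^+ n * u n @[n --> \oo] --> L ->
  2 ^+ n * (expR (u n) - 1) @[n --> \oo] --> L.
Proof.
move=> uL; have u0 : u n @[n --> \oo] --> (0 : R).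
  have -> : u = (fun n => (2 ^+ n * u n) * (1 / 2 ^+ n)).
    by apply/funext => n; field; rewrite expf_neq0.
  by rewrite -(mulr0 L); apply: cvgM => //; exact: cvg_div_2Xn.
apply: (@squeeze_cvgr _ _ _ _ (fun n => 2 ^+ n * u n)
    (fun n => (2 ^+ n * u n) / (1 - u n))).
- near=> n; have : u n < 1 by near: n; exact: (cvgr_lt 0 u0).
  set v := u n => v1.
  rewrite -mulrA !ler_pM2l ?exprn_gt0//.
  rewrite lerBrDl expR_ge1Dx /=.
  have h1 : 1 - v <= (expR v)^-1 by rewrite -expRN expR_ge1Dx.
  have h2 : 0 < 1 - v by rewrite subr_gt0.
  rewrite ler_pdivlMr// mulrBl mul1r lerBlDr.
  have : expR v * (1 - v) <= 1.
    by rewrite -ler_pdivlMl ?expR_gt0// mulr1.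
  by move=> h; rewrite (le_trans h)//; lra.
- exact: uL.
- rewrite -[X in _ --> X](divr1 L) -[in X in _ --> X](subr0 1).
  apply: cvgM; first exact: uL.
  apply: cvgV; first by rewrite subr0 oner_eq0.
  by apply: cvgB => //; exact: cvg_cst.
Unshelve. all: end_near. Qed.

Lemma cvg_expR_incr y : expR_incr n y @[n --> \oo] --> y.
Proof.
apply: cvg_expR_sub1.
rewrite (_ : (fun n => _) = cst y); first exact: cvg_cst.
by apply/funext => n /=; field; rewrite expf_neq0.
Qed.

(** The second difference of the exponential is the square of a symmetric first difference at half
    the step, which yields both its sign and its limit. *)
Lemma expR_incr2E n y :
  expR_incr2 n y = ((expR_incr n.+1 y - expR_incr n.+1 (- y)) / 2) ^+ 2.
Proof.
rewrite /expR_incr2 /expR_incr.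
have -> : y / 2 ^+ n = y / 2 ^+ n.+1 + y / 2 ^+ n.+1.
  by rewrite exprS; field; rewrite expf_neq0.
have -> : - y / 2 ^+ n = - (y / 2 ^+ n.+1) + - (y / 2 ^+ n.+1).
  by rewrite exprS; field; rewrite expf_neq0.
have -> : - y / 2 ^+ n.+1 = - (y / 2 ^+ n.+1) by rewrite mulNr.
have : expR (y / 2 ^+ n.+1) * expR (- (y / 2 ^+ n.+1)) = 1.
  by rewrite -expRD subrr expR0.
have -> : (4 : R) ^+ n = 2 ^+ n * 2 ^+ n by rewrite -exprMn -natrM.
rewrite !expRD exprS; set E := expR _; set F := expR _; set t := 2 ^+ n => EF.
have -> : E * E + F * F - 2 = (E - F) ^+ 2 
  by rewrite (_ : (E - F) ^+ 2 = E * E + F * F - 2 * (E * F)); [rewrite EF mulr1|ring].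
by field.
Qed.

Lemma expR_incr2_ge0 n y : 0 <= expR_incr2 n y.
Proof. by rewrite expR_incr2E sqr_ge0. Qed.

(** With [E] and [F = 1 / E] the exponentials at half the step, the drop is
    [4 ^+ n * (E + F - 2) ^+ 2]. *)
Lemma expR_incr2S n y : expR_incr2 n.+1 y <= expR_incr2 n y.
Proof.
rewrite /expR_incr2 -subr_ge0.
have -> : y / 2 ^+ n = y / 2 ^+ n.+1 + y / 2 ^+ n.+1.
  by rewrite exprS; field; rewrite expf_neq0.
have -> : - y / 2 ^+ n = - (y / 2 ^+ n.+1) + - (y / 2 ^+ n.+1).
  by rewrite exprS; field; rewrite expf_neq0.
have -> : - y / 2 ^+ n.+1 = - (y / 2 ^+ n.+1) by rewrite mulNr.
have : expR (y / 2 ^+ n.+1) * expR (- (y / 2 ^+ n.+1)) = 1.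
  by rewrite -expRD subrr expR0.
rewrite !expRD (exprS 4 n); set E := expR _; set F := expR _ => EF.
set t := 4 ^+ n.
have -> : t * (E * E + F * F - 2) - 4 * t * (E + F - 2) = t * (E + F - 2) ^+ 2.
  have -> : t * (E + F - 2) ^+ 2 = t * (E * E + F * F + 2 * (E * F) - 4 * (E + F) + 4) by ring.
  by rewrite EF; ring.
by rewrite mulr_ge0 ?sqr_ge0// exprn_ge0.
Qed.

Lemma cvg_expR_incr2 y : expR_incr2 n y @[n --> \oo] --> y ^+ 2.
Proof.
under eq_fun do rewrite expR_incr2E.
have -> : y ^+ 2 = ((y - - y) / 2) ^+ 2 by field.
under eq_fun do rewrite expr2; rewrite expr2.
have h u : expR_incr n.+1 u @[n --> \oo] --> u.
  by rewrite (cvg_shiftS (expR_incr^~ u)); exact: cvg_expR_incr.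
have hh : (expR_incr n.+1 y - expR_incr n.+1 (- y)) / 2 @[n --> \oo] --> (y - - y) / 2.
  by apply: cvgM; [apply: cvgB; exact: h|exact: cvg_cst].
by apply: cvgM; exact: hh.
Qed.

End dyadic_increments.

(** * Moments from the moment generating function *)

Section moments.
Local Open Scope ereal_scope.
Context d (T : measurableType d) (R : realType) (P : probability T R).
Variable y : T -> R.
Hypothesis my : measurable_fun setT y.

Let mexp (s : R) n : measurable_fun setT (fun x => expR (s * y x / 2 ^+ n)).
Proof.
apply: measurableT_comp => //; apply: measurable_funM => //.
exact: measurable_funM.
Qed.

Let iexp (s c : R) n : \int[P]_x (expR (s * y x / 2 ^+ n))%:E = c%:E ->
  P.-integrable setT (fun x => (expR (s * y x / 2 ^+ n))%:E).
Proof.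
move=> ic; apply/integrableP; split; first exact/measurable_EFinP.
under eq_integral => x _ do rewrite gee0_abs ?lee_fin ?expR_ge0//.
by rewrite ic ltry.
Qed.

(** The functions [expR_incr n (y x)] decrease to [y x] and have integral [2 ^+ n * (c n - 1)]. The
    generating function enters on one side of 0 only, which is all that an endpoint of the parameter
    interval offers. *)
Lemma mean_dyadic_mgf (c : nat -> R) (L : R) :
  (forall n, \int[P]_x (expR (y x / 2 ^+ n))%:E = (c n)%:E) ->
  (2 ^+ n * (c n - 1))%R @[n --> \oo] --> L ->
  P.-integrable setT (EFin \o y) /\ \int[P]_x (y x)%:E = L%:E.
Proof.
move=> ic cL.
have ic1 n : \int[P]_x (expR (1 * y x / 2 ^+ n))%:E = (c n)%:E.
  by rewrite -ic; apply: eq_integral => x _; rewrite mul1r.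
have i1 n : P.-integrable setT (EFin \o (fun x => expR (1 * y x / 2 ^+ n) - 1)%R).
  exact: (integrableB measurableT (iexp (ic1 n))
    (finite_measure_integrable_cst P 1%R measurableT)).
have qE n : EFin \o (fun x => expR_incr n (y x)) =
    (fun x => (2 ^+ n)%:E * (EFin \o (fun x => expR (1 * y x / 2 ^+ n) - 1)%R) x).
  by apply/funext => x; rewrite /= mul1r.
apply: (nonincreasing_cvg_integral (q := fun n x => expR_incr n (y x))
  (a := fun n => 2 ^+ n * (c n - 1))%R) => //.
- by move=> n; rewrite qE; exact: integrableZl.
- by move=> n x; exact: expR_incrS.
- by move=> x; exact: cvg_expR_incr.
- move=> n; rewrite (_ : (fun x => _) = EFin \o (fun x => expR_incr n (y x)))// qE.
  rewrite integralZl// integralB_EFin//; last 2 first.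
  - exact: iexp (ic1 n).
  - exact: finite_measure_integrable_cst.
  by rewrite ic1 integral_cst//= (_ : P setT = 1) ?mul1e//; exact: probability_setT.
Qed.

(** The functions [expR_incr2 n (y x)] are nonnegative and decrease in [n], so the one for [n = 0]
    dominates; it is integrable because the generating function is finite on both sides of 0. *)
Lemma second_moment_dyadic_mgf (c c' : nat -> R) :
  (forall n, \int[P]_x (expR (y x / 2 ^+ n))%:E = (c n)%:E) ->
  (forall n, \int[P]_x (expR (- y x / 2 ^+ n))%:E = (c' n)%:E) ->
  (4 ^+ n * (c n + c' n - 2))%:E @[n --> \oo] --> \int[P]_x (y x ^+ 2)%:E /\
  P.-integrable setT (fun x => (y x ^+ 2)%:E).
Proof.
move=> ic ic'.
have ic1 n : \int[P]_x (expR (1 * y x / 2 ^+ n))%:E = (c n)%:E.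
  by rewrite -ic; apply: eq_integral => x _; rewrite mul1r.
have ic1' n : \int[P]_x (expR (-1 * y x / 2 ^+ n))%:E = (c' n)%:E.
  by rewrite -ic'; apply: eq_integral => x _; rewrite mulN1r.
have i1 n : P.-integrable setT (EFin \o (fun x =>
    expR (1 * y x / 2 ^+ n) + expR (-1 * y x / 2 ^+ n))%R).
  exact: (integrableD measurableT (iexp (ic1 n)) (iexp (ic1' n))).
have i2 n : P.-integrable setT (EFin \o (fun x =>
    expR (1 * y x / 2 ^+ n) + expR (-1 * y x / 2 ^+ n) - 2)%R).
  exact: (integrableB measurableT (i1 n) (finite_measure_integrable_cst P 2%R measurableT)).
have qE n : EFin \o (fun x => expR_incr2 n (y x)) =
    (fun x => (4 ^+ n)%:E * (EFin \o (fun x =>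
    expR (1 * y x / 2 ^+ n) + expR (-1 * y x / 2 ^+ n) - 2)%R) x).
  by apply/funext => x; rewrite /= mul1r mulN1r.
have qi n : P.-integrable setT (EFin \o (fun x => expR_incr2 n (y x))).
  by rewrite qE; exact: integrableZl.
have qI n : \int[P]_x (expR_incr2 n (y x))%:E = (4 ^+ n * (c n + c' n - 2))%:E.
  rewrite (_ : (fun x => _) = EFin \o (fun x => expR_incr2 n (y x)))// qE.
  rewrite integralZl// integralB_EFin//; last exact: finite_measure_integrable_cst.
  rewrite (integralD_EFin measurableT (iexp (ic1 n)) (iexp (ic1' n))).
  rewrite ic1 ic1' integral_cst//= (_ : P setT = 1) ?mule1//; exact: probability_setT.
have [] := @dominated_convergence _ _ _ P setT measurableT
    (fun n x => (expR_incr2 n (y x))%:E) (fun x => (y x ^+ 2)%:E)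
    (fun x => (expR_incr2 0 (y x))%:E).
- by move=> n; have /integrableP[] := qi n.
- by apply/measurable_EFinP; exact: measurable_funX.
- apply: aeW => x _; apply: cvg_EFin; first exact: nearW.
  exact: cvg_expR_incr2.
- exact: qi.
- apply: aeW => x n _; rewrite gee0_abs ?lee_fin ?expR_incr2_ge0//.
  exact: ((nonincreasing_seqP (fun n => expR_incr2 n (y x))).1
    (fun n => expR_incr2S n (y x)) 0%N n).
- move=> h1 _ h2; split => //.
  by rewrite (_ : (fun n => _) = (fun n => \int[P]_x (expR_incr2 n (y x))%:E))//;
    apply/funext => n; rewrite qI.
Qed.

End moments.

(** * Derivatives within an interval *)

Section derivative_within_theory.
Variable R : realType.
Implicit Types (A : set R) (f g : R -> R).

Lemma derivative_within_cvg_seq A f g x (u : nat -> R) : derivative_within A f g ->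
  A x -> (forall n, A (u n)) -> (forall n, u n != x) -> u n @[n --> \oo] --> x ->
  (f (u n) - f x) / (u n - x) @[n --> \oo] --> g x.
Proof.
move=> fg Ax Au ux cu.
have cw : u n @[n --> \oo] --> within A x^'.
  move=> B; rewrite withinE/= => -[C xC CB].
  have [e/= e0 eC] := xC.
  move/cvgrPdist_lt : cu => /(_ _ e0) [N _ uN]; exists N => // n /= Nn.
  have : (C `&` A) (u n).
    by split => //; apply: eC; [exact: uN|exact: ux].
  by rewrite -CB => -[].
exact: (cvg_comp u (fun y => (f y - f x) / (y - x)) cw (fg x Ax)).
Qed.

Lemma derivative_within_nbhs A f g x (e : R) : derivative_within A f g ->
  A x -> 0 < e -> exists2 r, 0 < r &
    forall y, A y -> y != x -> `|y - x| < r ->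
      `|(f y - f x) / (y - x) - g x| < e.
Proof.
move=> fg Ax e0; have /cvgrPdist_lt /(_ _ e0) := fg x Ax.
rewrite /prop_near1 => -[r/= r0 h]; exists r => // y Ay yx yr.
by rewrite distrC; apply: h => //=; rewrite distrC.
Qed.

Lemma derivative_within_continuous A B f g : derivative_within A f g ->
  B `<=` A -> {within B, continuous f}.
Proof.
move=> fg BA; apply/subspace_continuousP => x Bx; apply/cvgrPdist_lt => e e0.
have [r r0 h] := derivative_within_nbhs fg (BA _ Bx) ltr01.
have k0 : 0 < `|g x| + 1 by rewrite ltr_wpDl.
exists (Num.min r (e / (`|g x| + 1))) => /=; first by rewrite lt_min r0 divr_gt0.
move=> y /=; rewrite lt_min distrC => /andP[yr ye] By.
have [->|yx] := eqVneq y x; first by rewrite subrr normr0.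
have y0 : 0 < `|y - x| by rewrite normr_gt0 subr_eq0.
have {}h := h y (BA _ By) yx yr.
have : `|(f y - f x) / (y - x)| < `|g x| + 1.
  by rewrite -ltrBlDl; apply: le_lt_trans h; exact: lerB_dist.
rewrite normrM normfV ltr_pdivrMr// distrC => /lt_le_trans; apply.
by rewrite -ler_pdivlMl// mulrC ltW.
Qed.

Lemma derivative_within_is_derive A f g a b x : derivative_within A f g ->
  is_interval A -> A a -> A b -> a < x < b -> is_derive x 1 f (g x).
Proof.
move=> fg iA Aa Ab /andP[ax xb].
have Ax : A x by apply: (iA a b) => //; rewrite !ltW.
suff H : h^-1 *: ((f \o shift x) h%:A - f x) @[h --> 0^'] --> g x.
  by have F1 : 'D_1 f x = g x by [apply: cvg_lim]; rewrite -F1 in H *; constructor.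
apply/cvgrPdist_lt => e e0.
have [r r0 h] := derivative_within_nbhs fg Ax e0.
exists (Num.min r (Num.min (x - a) (b - x))) => /=.
  by rewrite !lt_min r0 !subr_gt0 ax.
move=> y /=; rewrite sub0r normrN !lt_min => /and3P[yr ya yb] y0.
have Ay : A (y + x).
  apply: (iA a b) => //; move: ya yb; rewrite !ltr_norml => /andP[? _] /andP[_ ?].
  by apply/andP; split; lra.
have := h (y + x) Ay; rewrite addrK -subr_eq0 addrK distrC.
by rewrite [_%:A]mulr1 [_ *: _]mulrC; apply.
Qed.

Lemma derivative_within_MVT A f g a b : derivative_within A f g ->
  is_interval A -> A a -> A b -> a < b ->
  exists2 c, a < c < b & f b - f a = g c * (b - a).
Proof.
move=> fg iA Aa Ab ab.
have [|||c cab fE] := @MVT R f g a b.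
- by [].
- by move=> x; rewrite in_itv/=; exact: derivative_within_is_derive fg iA Aa Ab.
- apply: derivative_within_continuous fg _ => x/=; rewrite in_itv/= => xab.
  exact: (iA a b).
- by exists c.
Qed.

End derivative_within_theory.

(** * Bregman divergence of a strictly convex function *)

Section strictly_convex.
Variables (R : realType) (A : set R) (f f1 f2 : R -> R).
Hypotheses (iA : is_interval A) (ff1 : derivative_within A f f1).
Hypotheses (ff2 : derivative_within A f1 f2) (f2_gt0 : forall x, A x -> 0 < f2 x).

(** The tangent is taken at the first argument; for the log-partition function this is the
    divergence of the member with parameter [s] from the one with parameter [t]. *)
Definition bregman s t : R := f t - f s - (t - s) * f1 s.

Lemma slope_lt s t : A s -> A t -> s < t -> f1 s < f1 t.
Proof.
move=> As At st.
have [c /andP[sc ct] fE] := derivative_within_MVT ff2 iA As At st.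
rewrite -subr_gt0 fE mulr_gt0 ?subr_gt0//; apply: f2_gt0.
by apply: (iA As At); rewrite !ltW.
Qed.

Lemma slope_lt_mono : {in A &, {mono f1 : s t / s < t}}.
Proof.
move=> s t /set_mem As /set_mem At; apply/idP/idP; last exact: slope_lt.
apply: contraTT; rewrite -!leNgt le_eqVlt => /predU1P[->//|ts].
by rewrite ltW// slope_lt.
Qed.

Lemma slope_le_mono : {in A &, {mono f1 : s t / s <= t}}.
Proof. by move=> s t sA tA; rewrite !leNgt slope_lt_mono. Qed.

Lemma slope_inj s t : A s -> A t -> f1 s = f1 t -> s = t.
Proof.
move=> As At st; have [ts|ts|//] := ltgtP s t.
- by have := slope_lt As At ts; rewrite st ltxx.
- by have := slope_lt At As ts; rewrite st ltxx.
Qed.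

Lemma slope_IVT s t y : A s -> A t -> f1 s <= y <= f1 t ->
  exists2 u, A u & f1 u = y.
Proof.
move=> As At syt; have st : s <= t.
  by rewrite -slope_le_mono ?inE//; case/andP : syt => /le_trans; exact.
have [||u] := @IVT R f1 s t y st.
- apply: derivative_within_continuous ff2 _ => x/=; rewrite in_itv/= => xab.
  exact: (iA As At).
- rewrite min_l ?max_r//; by rewrite slope_le_mono ?inE.
- by rewrite in_itv/= => sut <-; exists u => //; exact: (iA As At).
Qed.

Lemma bregmanxx s : bregman s s = 0.
Proof. by rewrite /bregman !subrr mul0r subrr. Qed.

Lemma bregman_gt0 s t : A s -> A t -> s != t -> 0 < bregman s t.
Proof.
move=> As At; rewrite neq_lt /bregman => /orP[st|ts].
- have [c /andP[sc ct] ->] := derivative_within_MVT ff1 iA As At st.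
  have Ac : A c by apply: (iA As At); rewrite !ltW.
  by rewrite (mulrC (t - s)) -mulrBl mulr_gt0 ?subr_gt0// slope_lt.
- have [c /andP[tc cs] E] := derivative_within_MVT ff1 iA At As ts.
  have Ac : A c by apply: (iA At As); rewrite !ltW.
  rewrite -(opprB (f s)) E (_ : _ - _ = (f1 s - f1 c) * (s - t)); last ring.
  by rewrite mulr_gt0 ?subr_gt0// slope_lt.
Qed.

Lemma bregman_ge0 s t : A s -> A t -> 0 <= bregman s t.
Proof.
move=> As At; have [->|st] := eqVneq s t; first by rewrite bregmanxx.
by rewrite ltW// bregman_gt0.
Qed.

(** For [s], [u], [t] in monotone order and [f1] increasing, the last term is nonnegative: this is
    the source of superadditivity. *)
Lemma bregman_cosines s u t :
  bregman s t = bregman s u + bregman u t + (t - u) * (f1 u - f1 s).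
Proof. by rewrite /bregman; ring. Qed.

Lemma bregman_continuous t B : B `<=` A -> {within B, continuous (bregman^~ t)}.
Proof.
move=> BA; have cf := derivative_within_continuous ff1 BA.
have cf1 := derivative_within_continuous ff2 BA.
have ci : {within B, continuous (fun x : R => x)}.
  by apply: continuous_subspaceT => x; exact: cvg_id.
move=> x; apply: cvgB.
  by apply: cvgB; [exact: cvg_cst|exact: cf].
by apply: cvgM; [apply: cvgB; [exact: cvg_cst|exact: ci]|exact: cf1].
Qed.

Lemma bregman_IVT s t c : A s -> A t -> s < t -> 0 <= c <= bregman s t ->
  exists2 u, s <= u <= t & bregman u t = c.
Proof.
move=> As At st /andP[c0 cst].
have [||u] := @IVT R (bregman^~ t) s t c (ltW st).
- apply: bregman_continuous => x/=; rewrite in_itv/= => xst.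
  exact: (iA As At).
- by rewrite bregmanxx min_r ?max_l ?c0//; exact: le_trans cst.
- by rewrite in_itv/= => sut <-; exists u.
Qed.

(** The difference of the two sides, as a function [psi] of [t], vanishes at [s] and has derivative
    [2 * (f1 u - f1 s) * (D - f2 u)], of the sign of [u - s]; the mean value theorem concludes. *)
Lemma bregman_quadratic (D lo hi s t : R) : A lo -> A hi ->
  (forall x, lo < x < hi -> f2 x <= D) ->
  lo <= s <= hi -> lo <= t <= hi ->
  (f1 t - f1 s) ^+ 2 <= 2 * D * bregman s t.
Proof.
move=> Alo Ahi f2D slh tlh.
have As : A s by exact: (iA Alo Ahi).
have At : A t by exact: (iA Alo Ahi).
have [->|st] := eqVneq s t; first by rewrite bregmanxx mulr0 subrr expr0n.
pose psi u := 2 * D * bregman s u - (f1 u - f1 s) * (f1 u - f1 s).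
pose dpsi u := 2 * (f1 u - f1 s) * (D - f2 u).
suff : 0 <= psi t by rewrite /psi subr_ge0 expr2.
have psi0 : psi s = 0 by rewrite /psi bregmanxx mulr0 subrr mulr0 subrr.
have dpsiE x : lo < x < hi -> is_derive x 1 psi (dpsi x).
  move=> xlh.
  have d1 := derivative_within_is_derive ff1 iA Alo Ahi xlh.
  have d2 := derivative_within_is_derive ff2 iA Alo Ahi xlh.
  rewrite /psi /bregman.
  apply: is_derive_eq.
  rewrite /dpsi /GRing.scale/=; ring.
have cpsi a b : lo <= a -> b <= hi -> {within `[a, b], continuous psi}.
  move=> la bh.
  have BA : `[a, b] `<=` A.
    move=> x/=; rewrite in_itv/= => /andP[ax xb]; apply: (iA Alo Ahi).
    by rewrite (le_trans la)//= (le_trans xb).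
  have cf := derivative_within_continuous ff1 BA.
  have cf1 := derivative_within_continuous ff2 BA.
  have ci : {within `[a, b], continuous (fun x : R => x)}.
    by apply: continuous_subspaceT => x; exact: cvg_id.
  move=> x; apply: cvgB.
    apply: cvgM; first exact: cvg_cst.
    apply: cvgB; first by apply: cvgB; [exact: cf|exact: cvg_cst].
    by apply: cvgM; [apply: cvgB; [exact: ci|exact: cvg_cst]|exact: cvg_cst].
  by apply: cvgM; (apply: cvgB; [exact: cf1|exact: cvg_cst]).
case/andP : slh => ls sh; case/andP : tlh => lt th.
move: st; rewrite neq_lt => /orP[st|ts].
- have [||c] := @MVT R psi dpsi s t st.
  + move=> x; rewrite in_itv/= => /andP[sx xt]; apply: dpsiE.
    by rewrite (le_lt_trans ls)//= (lt_le_trans xt).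
  + exact: cpsi.
  rewrite in_itv/= psi0 subr0 => /andP[sc ct] ->.
  have clh : lo < c < hi by rewrite (le_lt_trans ls)//= (lt_le_trans ct).
  have Ac : A c by apply: (iA As At); rewrite !ltW.
  apply: mulr_ge0; last by rewrite subr_ge0 ltW.
  apply: mulr_ge0; last by rewrite subr_ge0 f2D.
  by rewrite mulr_ge0// subr_ge0 ltW// slope_lt.
- have [||c] := @MVT R psi dpsi t s ts.
  + move=> x; rewrite in_itv/= => /andP[sx xt]; apply: dpsiE.
    by rewrite (le_lt_trans lt)//= (lt_le_trans xt).
  + exact: cpsi.
  rewrite in_itv/= psi0 sub0r => /andP[tc cs] E.
  rewrite -oppr_le0 E.
  have clh : lo < c < hi by rewrite (le_lt_trans lt)//= (lt_le_trans cs).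
  have Ac : A c by apply: (iA At As); rewrite !ltW.
  apply: mulr_le0_ge0; last by rewrite subr_ge0 ltW.
  apply: mulr_le0_ge0; last by rewrite subr_ge0 f2D.
  by rewrite mulr_ge0_le0// subr_le0 ltW// slope_lt.
Qed.

(** Close to [s] the slopes of [f1] from [s] exceed [c], so
    [G u = bregman s u - c / 2 * (u - s) ^+ 2] has a derivative of the sign of [u - s], and
    [G s = 0]. *)
Lemma bregman_second_order c s : A s -> c < f2 s ->
  exists2 r, 0 < r & forall t, A t -> `|t - s| < r ->
    c / 2 * (t - s) ^+ 2 <= bregman s t.
Proof.
move=> As cs.
have e0 : 0 < f2 s - c by rewrite subr_gt0.
have [r r0 hr] := derivative_within_nbhs ff2 As e0.
exists r => // t At tr.
have slope u : A u -> u != s -> `|u - s| < r -> c < (f1 u - f1 s) / (u - s).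
  by move=> Au us ur; have := hr u Au us ur; rewrite ltr_norml => /andP[+ _]; lra.
have [->|st] := eqVneq t s; first by rewrite subrr expr0n mulr0 bregmanxx.
pose G u := bregman s u - c / 2 * ((u - s) * (u - s)).
pose dG u := (f1 u - f1 s) - c * (u - s).
have Gs : G s = 0 by rewrite /G bregmanxx subrr mulr0 mulr0 subrr.
suff : 0 <= G t by rewrite /G subr_ge0 expr2.
have dGE p q x : A p -> A q -> x \in `]p, q[ -> is_derive x 1 G (dG x).
  rewrite in_itv/= => Ap Aq xpq.
  have d1 := derivative_within_is_derive ff1 iA Ap Aq xpq.
  rewrite /G /bregman; apply: is_derive_eq.
  rewrite /dG /GRing.scale/=; by field.
have cG p q : A p -> A q -> {within `[p, q], continuous G}.
  move=> Ap Aq.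
  have BA : `[p, q] `<=` A by move=> x/=; rewrite in_itv/=; exact: (iA Ap Aq).
  have cf := derivative_within_continuous ff1 BA.
  have ci : {within `[p, q], continuous (fun x : R => x)}.
    by apply: continuous_subspaceT => x; exact: cvg_id.
  move=> x; apply: cvgB.
    apply: cvgB; first by apply: cvgB; [exact: cf|exact: cvg_cst].
    by apply: cvgM; [apply: cvgB; [exact: ci|exact: cvg_cst]|exact: cvg_cst].
  apply: cvgM; first exact: cvg_cst.
  by apply: cvgM; (apply: cvgB; [exact: ci|exact: cvg_cst]).
move: tr; move: st; rewrite neq_lt => /orP[ts|st] tr.
- have [u] := MVT ts (dGE t s ^~ At ^~ As) (cG t s At As).
  rewrite in_itv/= Gs sub0r => /andP[tu us] E; rewrite -oppr_le0 E.
  apply: mulr_le0_ge0; last by rewrite subr_ge0 ltW.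
  have Au : A u by apply: (iA At As); rewrite !ltW.
  have ur : `|u - s| < r.
    by apply: le_lt_trans tr; rewrite !ltr0_norm ?subr_lt0// lerN2 lerB// ltW.
  have := slope u Au; rewrite lt_eqF// => /(_ isT ur).
  by rewrite ltr_ndivlMr ?subr_lt0// /dG => ?; rewrite subr_le0 ltW.
- have [u] := MVT st (dGE s t ^~ As ^~ At) (cG s t As At).
  rewrite in_itv/= Gs subr0 => /andP[su ut] ->.
  apply: mulr_ge0; last by rewrite subr_ge0 ltW.
  have Au : A u by apply: (iA As At); rewrite !ltW.
  have ur : `|u - s| < r.
    by apply: le_lt_trans tr; rewrite !gtr0_norm ?subr_gt0// lerB// ltW.
  have := slope u Au; rewrite gt_eqF// => /(_ isT ur).
  by rewrite ltr_pdivlMr ?subr_gt0// /dG => ?; rewrite subr_ge0 ltW.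
Qed.

End strictly_convex.

(** * Mean and variance of the members of a family *)

Section members.
Context (R : realType) (m : {measure set (measurableTypeR R) -> \bar R}).
Variable Theta : set R.
Hypothesis finZ : forall theta, Theta theta ->
  (0 < partition_function m theta < +oo)%E.

Local Notation b := (log_partition m).

Definition has_param (theta : R) (P : law R) := forall A, measurable A ->
  P A = (\int[m]_(x in A) (expR (x * theta - b theta))%:E)%E.

Lemma measurable_expR_linear (s c : R) :
  measurable_fun [set: measurableTypeR R] (fun x : R => expR (x * s + c)).
Proof.
apply: measurableT_comp => //; apply: measurable_funD => //.
exact: measurable_funM.
Qed.

Lemma partition_functionE theta : Theta theta ->
  partition_function m theta = (expR (b theta))%:E.
Proof.
move=> /finZ /andP[Z0 Zoo]; rewrite /b /log_partition lnK ?fineK//.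
- by rewrite ge0_fin_numE// ltW.
- by rewrite posrE fine_gt0// Z0.
Qed.

Lemma member_mgf (P : law R) (theta theta' : R) :
  Theta theta -> Theta theta' -> has_param theta P ->
  (\int[P]_x (expR (x * (theta' - theta)))%:E =
   (expR (b theta' - b theta))%:E)%E.
Proof.
move=> Tt Tt' PE.
rewrite (@ge0_integral_density _ _ _ m P
  (fun x => expR (x * theta - b theta)) (measurable_expR_linear theta (- b theta))
  (fun x => expR_ge0 _) PE)//; last first.
- apply/measurable_EFinP; under eq_fun do rewrite -[_ * _]addr0.
  exact: measurable_expR_linear.
transitivity (\int[m]_x ((expR (- b theta))%:E * (expR (x * theta'))%:E))%E.
  apply: eq_integral => x _; rewrite -!EFinM -!expRD; congr (expR _)%:E.
  ring.
rewrite ge0_integralZl//; last first.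
  apply/measurable_EFinP; under eq_fun do rewrite -[_ * _]addr0.
  exact: measurable_expR_linear.
rewrite addrC expRD EFinM -(partition_functionE Tt').
by [].
Qed.

Lemma has_param_exists theta : Theta theta -> exists P, has_param theta P.
Proof.
move=> Tt.
pose f x : \bar R := (expR (x * theta - b theta))%:E.
have mf : measurable_fun [set: measurableTypeR R] f.
  by apply/measurable_EFinP; exact: measurable_expR_linear.
have f0 x : (0 <= f x)%E by rewrite lee_fin expR_ge0.
pose nu (A : set (measurableTypeR R)) : \bar R := (\int[m]_(x in A) f x)%E.
have nu0 : nu set0 = 0%E by rewrite /nu integral_set0.
have nu_ge0 A : (0 <= nu A)%E by exact: integral_ge0.
have nu_sigma : semi_sigma_additive nu by exact: semi_sigma_additive_nng_induced.
pose M := isMeasure.Build _ _ _ nu nu0 nu_ge0 nu_sigma.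
pose mu : {measure set (measurableTypeR R) -> \bar R} := HB.pack nu M.
have mu1 : mu setT = 1%E.
  rewrite /mu/= /nu /f.
  under eq_integral do rewrite addrC expRD EFinM.
  rewrite ge0_integralZl//.
  - rewrite (_ : integral _ _ _ = partition_function m theta)//.
    by rewrite partition_functionE// -EFinM -expRD addNr expR0.
  - apply/measurable_EFinP; under eq_fun do rewrite -[_ * _]addr0.
    exact: measurable_expR_linear.
pose P : law R := HB.pack nu M (Measure_isProbability.Build _ _ _ mu mu1).
by exists P => A mA.
Qed.

Lemma member_mgf_shift (P : law R) (theta theta' k : R) :
  Theta theta -> Theta theta' -> has_param theta P ->
  (\int[P]_x (expR (x * (theta' - theta) + k))%:E =
   (expR (b theta' - b theta + k))%:E)%E.
Proof.
move=> Tt Tt' PE; rewrite expRD mulrC EFinM -(member_mgf Tt Tt' PE).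
rewrite -[RHS]ge0_integralZl//.
- by apply: eq_integral => x _; rewrite -EFinM -expRD addrC.
- apply/measurable_EFinP; under eq_fun do rewrite -[_ * _]addr0.
  exact: measurable_expR_linear.
Qed.

Variables b1 b2 : R -> R.
Hypothesis iTheta : is_interval Theta.
Hypotheses (bb1 : derivative_within Theta b b1) (b1b2 : derivative_within Theta b1 b2).

Let dyadic_step theta h0 n : Theta theta -> Theta (theta + h0) -> h0 != 0 ->
  [/\ Theta (theta + h0 / 2 ^+ n), theta + h0 / 2 ^+ n != theta &
   theta + h0 / 2 ^+ n @[n --> \oo] --> theta].
Proof.
move=> Tt Tt0 h0N.
have p0 : 0 < 2 ^+ n :> R by rewrite exprn_gt0.
have p1 : 1 <= 2 ^+ n :> R by rewrite exprn_ege1// ler1n.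
split.
- have [hpos|hneg] := leP 0 h0.
    apply: (iTheta Tt Tt0); rewrite lerDl lerD2l ler_pdivrMr// ler_peMr// andbT.
    by rewrite divr_ge0// ltW.
  apply: (iTheta Tt0 Tt); rewrite gerDl lerD2l ler_pdivlMr// pmulr_lle0 ?invr_gt0//.
  by rewrite (ltW hneg) andbT ler_neMr// ltW.
- by rewrite -subr_eq0 addrC addKr mulf_neq0// invr_neq0// gt_eqF.
- rewrite -[X in _ --> X]addr0; apply: cvgD; first exact: cvg_cst.
  exact: cvg_div_2Xn.
Qed.

(** Dyadic steps from [theta] towards a second parameter [theta0] stay in the interval, even when
    [theta] is an endpoint; along them the mean of [x * h0] is the limit of scaled increments of
    [b]. *)
Lemma member_mean (P : law R) theta theta0 : Theta theta -> Theta theta0 ->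
  theta0 != theta -> has_param theta P ->
  P.-integrable setT (fun x : measurableTypeR R => (x%:E : \bar R)) /\
  (\int[P]_x (x : measurableTypeR R)%:E = (b1 theta)%:E)%E.
Proof.
move=> Tt Tt0 t0t PE; pose h0 := theta0 - theta.
have h0N : h0 != 0 by rewrite subr_eq0.
have Tth0 : Theta (theta + h0) by rewrite addrC subrK.
have stp n := dyadic_step n Tt Tth0 h0N.
have [|||] := @mean_dyadic_mgf _ _ R P (fun x : measurableTypeR R => x * h0) _
    (fun n => expR (b (theta + h0 / 2 ^+ n) - b theta)) (h0 * b1 theta).
- exact: measurable_funM.
- move=> n; have [T1 _ _] := stp n.
  rewrite -(member_mgf Tt T1 PE); apply: eq_integral => x _.
  by rewrite -mulrA addrAC subrr add0r.
- apply: cvg_expR_sub1.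
  have /= := derivative_within_cvg_seq bb1 Tt (fun n => let: And3 h _ _ := stp n in h)
    (fun n => let: And3 _ h _ := stp n in h) (let: And3 _ _ h := stp 0%N in h).
  move/(cvgM (cvg_cst h0)); apply: cvg_trans; apply: near_eq_cvg.
  apply: nearW => n /=; rewrite (addrC theta) addrK.
  have : 2 ^+ n != 0 :> R by rewrite expf_neq0.
  set E := (X in _ * (X / _) = _); rewrite -/E.
  by move: E (2 ^+ n) => E p p0; field; rewrite h0N p0.
move=> i1 e1.
have xE : (fun x : measurableTypeR R => x%:E) =
    (fun x => (h0^-1)%:E * (EFin \o (fun x : measurableTypeR R => x * h0)%R) x)%E.
  by apply/funext => x; rewrite /= -EFinM mulrC mulfK.
split; first by rewrite xE; exact: integrableZl.
rewrite xE integralZl//; rewrite /comp e1 -EFinM mulrA mulVf// mul1r//.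
Qed.

(** This direction turns an upper bound on the variance into one on [b2]. The symmetric increments
    of the generating function of [h * (x - mu)] tend to [h ^+ 2 * var P], while [expR z >= 1 + z]
    and the second-order bound on the Bregman divergence keep them above
    [h ^+ 2 * (b2 theta - e)]. *)
Lemma member_var (P : law R) theta h : 0 < h ->
  Theta (theta - h) -> Theta (theta + h) -> has_param theta P -> 
  b2 theta <= var P.
Proof.
move=> h0 TtN TtD PE.
have Tt : Theta theta.
  by apply: (iTheta TtN TtD); rewrite lerBlDr !lerDl ltW.
have hN : h != 0 by rewrite gt_eqF.
have hNN : - h != 0 by rewrite oppr_eq0.
have tDN : theta + h != theta by rewrite -subr_eq0 addrC addKr.
have [i1 e1] := member_mean Tt TtD tDN PE.
set mu := b1 theta in e1 *.
have varE : variance P (fun x => x) = (\int[P]_x ((x - mu) ^+ 2)%:E)%E.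
  rewrite /variance covariance.unlock expectation.unlock e1/=.
  by apply: eq_integral => x _; rewrite expr2.
have stpD n := dyadic_step n Tt TtD hN.
have stpN n := dyadic_step n Tt TtN hNN.
have my : measurable_fun [set: measurableTypeR R] (fun x : R => h * (x - mu)).
  by apply: measurable_funM => //; exact: measurable_funB.
pose u n := theta + h / 2 ^+ n; pose v n := theta + - h / 2 ^+ n.
have Tu n : Theta (u n) by have [] := stpD n.
have Tv n : Theta (v n) by have [] := stpN n.
have [||cv i2] := @second_moment_dyadic_mgf _ _ R P _ my
    (fun n => expR (b (u n) - b theta + - (h / 2 ^+ n * mu)))
    (fun n => expR (b (v n) - b theta + h / 2 ^+ n * mu)).
- move=> n; rewrite -(member_mgf_shift _ Tt (Tu n) PE); apply: eq_integral => x _.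
  by congr (expR _)%:E; rewrite /u; field; rewrite expf_neq0.
- move=> n; rewrite -(member_mgf_shift _ Tt (Tv n) PE); apply: eq_integral => x _.
  by congr (expR _)%:E; rewrite /v; field; rewrite expf_neq0.
have hx2 x : ((h * (x - mu)) ^+ 2)%:E = ((h ^+ 2)%:E * ((x - mu) ^+ 2)%:E)%E :> \bar R.
  by rewrite -EFinM exprMn.
have mx2 : measurable_fun [set: measurableTypeR R] (fun x : R => ((x - mu) ^+ 2)%:E : \bar R).
  by apply/measurable_EFinP; apply: measurable_funX; exact: measurable_funB.
have i3 : P.-integrable setT (fun x : measurableTypeR R => ((x - mu) ^+ 2)%:E : \bar R).
  have -> : (fun x : measurableTypeR R => ((x - mu) ^+ 2)%:E : \bar R) =
      (fun x => ((h ^- 2)%:E * ((h * (x - mu)) ^+ 2)%:E)%E).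
    by apply/funext => x; rewrite -EFinM exprMn mulKf// expf_neq0.
  exact: integrableZl.
have vfin : (\int[P]_x ((h * (x - mu)) ^+ 2)%:E = (h ^+ 2 * var P)%:E)%E.
  rewrite /var varE EFinM fineK; last exact: integrable_fin_num.
  by rewrite -integralZl//; apply: eq_integral => x _; rewrite hx2.
rewrite vfin in cv; move/fine_cvg : cv; rewrite /= => cv.
apply/ler_addgt0Pr => e e0.
have ce : b2 theta - e < b2 theta by rewrite gtrBl.
rewrite -lerBlDr -(ler_pM2l (exprn_gt0 2 h0)).
have [r r0 hr] := bregman_second_order iTheta bb1 b1b2 Tt ce.
rewrite -(cvg_lim _ cv)//; apply: limr_ge; first exact: cvgP cv.
near=> n.
have p0 : 2 ^+ n != 0 :> R by rewrite expf_neq0.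
have hn : `|h / 2 ^+ n| < r.
  near: n; have /cvgrPdist_lt := cvg_div_2Xn h; move=> /(_ _ r0).
  by apply: filterS => n; rewrite sub0r normrN.
have hu : (b2 theta - e) / 2 * (u n - theta) ^+ 2 <= bregman b b1 theta (u n).
  by apply: hr => //; rewrite /u (addrC theta) addrK.
have hv : (b2 theta - e) / 2 * (v n - theta) ^+ 2 <= bregman b b1 theta (v n).
  by apply: hr => //; rewrite /v (addrC theta) addrK mulNr normrN.
have eu := expR_ge1Dx (b (u n) - b theta + - (h / 2 ^+ n * mu)).
have ev := expR_ge1Dx (b (v n) - b theta + h / 2 ^+ n * mu).
(* As [mu = b1 theta], the Bregman divergence at [u n] is exactly the logarithm of the centred
   generating function there; likewise at [v n]. *)
have {}hu : (b2 theta - e) / 2 * (h / 2 ^+ n) ^+ 2 <= b (u n) - b theta + - (h / 2 ^+ n * mu).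
  by move: hu; rewrite /bregman /u (addrC theta) addrK.
have {}hv : (b2 theta - e) / 2 * (h / 2 ^+ n) ^+ 2 <= b (v n) - b theta + h / 2 ^+ n * mu.
  by move: hv; rewrite /bregman /v (addrC theta) addrK mulNr sqrrN mulNr opprK.
have -> : h ^+ 2 * (b2 theta - e) =
    4 ^+ n * ((b2 theta - e) * (h / 2 ^+ n) ^+ 2).
  rewrite (_ : 4 = 2 * 2); last by rewrite -natrM.
  by rewrite exprMn; field.
rewrite ler_pM2l ?exprn_gt0//.
set E1 := expR _ in eu *; set E2 := expR _ in ev *.
set X := (h / 2 ^+ n) ^+ 2 in hu hv *.
have h1 : (b2 theta - e) * X / 2 <= E1 - 1.
  by rewrite lerBrDl (le_trans _ eu)// lerD2l mulrAC.
have h2 : (b2 theta - e) * X / 2 <= E2 - 1.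
  by rewrite lerBrDl (le_trans _ ev)// lerD2l mulrAC.
rewrite [leLHS]splitr (_ : E1 + E2 - 2 = (E1 - 1) + (E2 - 1)) ?lerD//.
by rewrite addrACA -opprD.
Unshelve. all: end_near. Qed.

End members.

(** * Kullback-Leibler divergence as a Bregman divergence *)

Section kullback_leibler.
Context (R : realType) (m : {measure set (measurableTypeR R) -> \bar R}).
Variable Theta : set R.
Hypothesis finZ : forall theta, Theta theta ->
  (0 < partition_function m theta < +oo)%E.

Local Notation b := (log_partition m).

Lemma member_density (P Q : law R) s t A : has_param m s P -> has_param m t Q ->
  measurable A ->
  P A = (\int[Q]_(x in A) (expR (x * (s - t) + (b t - b s)))%:E)%E.
Proof.
move=> PE QE mA; rewrite PE//.
have mg u k : measurable_fun setT
    (fun x : measurableTypeR R => (expR (x * u + k))%:E : \bar R).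
  by apply/measurable_EFinP; exact: measurable_expR_linear.
rewrite integral_mkcond [RHS]integral_mkcond.
rewrite (@ge0_integral_density _ _ _ m Q
  (fun x => expR (x * t - b t)) (measurable_expR_linear t (- b t))
  (fun x => expR_ge0 _) QE)//; last 2 first.
- apply: (measurable_restrictT _ mA).1; exact: measurable_funTS (mg (s - t) (b t - b s)).
- by move=> x; apply: erestrict_ge0 => y _; rewrite lee_fin expR_ge0.
apply: eq_integral => x _; rewrite !patchE; case: ifPn => _; last by rewrite mul0e.
rewrite -EFinM -expRD; congr (expR _)%:E.
by move: (b s) (b t) => u v; ring.
Qed.

Lemma member_dominates (P Q : law R) s t : has_param m s P -> has_param m t Q ->
  P `<< Q.
Proof.
move=> PE QE; apply/null_content_dominatesP => A mA QA0.
rewrite (member_density PE QE)//; apply: null_set_integral => //.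
apply: measurable_funTS; apply/measurable_EFinP; exact: measurable_expR_linear.
Qed.

(** The Radon-Nikodym derivative agrees [Q]-almost everywhere, hence [P]-almost everywhere by
    domination, with the explicit exponential ratio, whose logarithm is affine in [x]; the mean of
    [P] then gives the integral. *)
Lemma KL_bregman (P Q : law R) (b1 : R -> R) s t : has_param m s P -> has_param m t Q ->
  P.-integrable setT (fun x : measurableTypeR R => (x%:E : \bar R)) ->
  (\int[P]_x (x : measurableTypeR R)%:E = (b1 s)%:E)%E ->
  KL P Q = bregman b b1 s t.
Proof.
move=> PE QE iP eP.
have dPQ := member_dominates PE QE.
pose RN := Radon_Nikodym (charge_of_finite_measure P) Q.
have iRN : Q.-integrable setT RN by exact: Radon_Nikodym_integrable.
have mRN : measurable_fun setT RN by exact: measurable_int iRN.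
pose g (x : measurableTypeR R) := (expR (x * (s - t) + (b t - b s)))%:E : \bar R.
have mg : measurable_fun setT g.
  by apply/measurable_EFinP; exact: measurable_expR_linear.
have RNg : ae_eq Q setT RN g.
  apply: integral_ae_eq => // E _ mE.
  by rewrite -Radon_Nikodym_integral//= (member_density PE QE).
have iln : (\int[P]_x (ln (fine (RN x)))%:E =
    \int[P]_x ((x * (s - t) + (b t - b s)))%:E)%E.
  apply: ae_eq_integral => //.
  - apply/measurable_EFinP; apply: measurableT_comp; first exact: measurable_ln.
    exact: measurableT_comp.
  - by apply/measurable_EFinP; apply: measurable_funD => //; exact: measurable_funM.
  - case: RNg => N [mN QN0 sN]; exists N; split => //.
      by have /null_content_dominatesP := dPQ; apply.
    apply: subset_trans sN => x /= nx nR; apply: nx => _.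
    by rewrite nR//= expRK.
rewrite /KL /Rintegral -/RN iln.
have -> : (fun x : measurableTypeR R => (x * (s - t) + (b t - b s))%:E) =
    ((fun x : measurableTypeR R => (s - t)%:E * x%:E) \+ (EFin \o cst (b t - b s)%R))%E.
  by apply/funext => x /=; rewrite -EFinM -EFinD mulrC.
rewrite integralD//; last 2 first.
- exact: integrableZl.
- exact: finite_measure_integrable_cst.
have ec := expectation_cst P (b t - b s); rewrite expectation.unlock in ec.
rewrite integralZl// eP [X in (_ + X)%E](_ : _ = (b t - b s)%:E)//=.
rewrite /bregman.
by move: (b s) (b t) (b1 s) => u v w; ring.
Qed.

End kullback_leibler.

(** The interface between the family and the bandit analysis, which works with means only and never
    with the natural parameter. [KLm_mgf] supplies the Chernoff exponent, with the sign of the tilt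
    [l] deciding the tail. *)
Record kl_geometry (R : realType) (F : set (law R)) : Prop := KLGeometry {
  means_itv : is_interval (means F);
  KLmxx : forall x, means F x -> KLm F x x = 0;
  KLm_ge0 : forall x y, means F x -> means F y -> 0 <= KLm F x y;
  KLm_gt0 : forall x y, means F x -> means F y -> x < y -> 0 < KLm F x y;
  KLm_superadd_le : forall x y z, means F x -> means F y -> means F z ->
    x <= y <= z -> KLm F x y + KLm F y z <= KLm F x z;
  KLm_superadd_ge : forall x y z, means F x -> means F y -> means F z ->
    z <= y <= x -> KLm F x y + KLm F y z <= KLm F x z;
  KLm_IVT : forall x y c, means F x -> means F y -> x < y ->
    0 <= c <= KLm F x y ->
    exists u, [/\ means F u, x <= u <= y & KLm F u y = c];
  KLm_mgf : forall nu x, F nu -> means F x ->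
    exists l, [/\ x <= mean nu -> l <= 0, mean nu <= x -> 0 <= l &
      (\int[nu]_y (expR (l * (y - x)))%:E = (expR (- KLm F x (mean nu)))%:E)%E];
  KLm_quadratic : forall D lo hi x y, means F lo -> means F hi ->
    (forall mu, lo < mu < hi -> variance_function F mu <= D) ->
    lo <= x <= hi -> lo <= y <= hi -> (y - x) ^+ 2 <= 2 * D * KLm F x y }.

Section expfam_geometry.
Context (R : realType) (m : {measure set (measurableTypeR R) -> \bar R}).
Variable Theta : set R.

Local Notation b := (log_partition m).
Local Notation F := (expfam m Theta).

(** Two members with distinct means exclude a one-point [Theta], on which a derivative within
    [Theta] carries no information and [b1] need not be the mean. *)
Lemma expfam_kl_geometry (P0 Q0 : law R) : regular_expfam m Theta ->
  F P0 -> F Q0 -> mean P0 != mean Q0 -> kl_geometry F.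
Proof.
move=> [iT finZ [b1 [b2 [bb1 b1b2 _ b2pos]]]] [s0 Ts0 P0s] [t0 Tt0 Q0t] PQ0.
have st0 : s0 != t0.
  apply: contra PQ0 => /eqP st; apply/eqP; rewrite /mean expectation.unlock.
  congr fine; apply: eq_measure_integral => A mA _.
  by rewrite [LHS](P0s A mA) [RHS](Q0t A mA) st.
have other s : Theta s -> exists2 t, Theta t & t != s.
  move=> Ts; have [->|ss0] := eqVneq s s0; first by exists t0 => //; rewrite eq_sym.
  by exists s0 => //; rewrite eq_sym.
have pm P s : Theta s -> has_param m s P ->
    P.-integrable setT (fun x : measurableTypeR R => (x%:E : \bar R)) /\
    (\int[P]_x (x : measurableTypeR R)%:E = (b1 s)%:E)%E.
  by move=> Ts Ps; have [t Tt ts] := other s Ts; exact: (member_mean finZ iT bb1 Ts Tt ts Ps).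
have pmean P s : Theta s -> has_param m s P -> mean P = b1 s.
  by move=> Ts Ps; rewrite /mean expectation.unlock (pm P s Ts Ps).2.
have meansE x : means F x -> exists2 s, Theta s & x = b1 s.
  by move=> [P [s Ts Ps] <-]; exists s => //; exact: pmean.
have means_b1 s : Theta s -> means F (b1 s).
  move=> Ts; have [P Ps] := has_param_exists finZ Ts.
  by exists P; [exists s|exact: pmean].
(* The choice made by [member] is not the junk value here, and injectivity of [b1] forces its
   parameter to be [s]. *)
have memb s : Theta s -> has_param m s (member F (b1 s)).
  move=> Ts; rewrite /member; set G := [set P | _].
  have : G (xget (dirac (0 : measurableTypeR R) : law R) G).
    have [P FP mP] := means_b1 s Ts; exact: (xgetPex _ (ex_intro _ P (conj FP mP))).
  move=> [[s' Ts' Ps'] ms']; have <- // : s' = s.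
  by apply: (slope_inj iT b1b2 b2pos Ts' Ts); rewrite -(pmean _ _ Ts' Ps').
have klE s t : Theta s -> Theta t -> KLm F (b1 s) (b1 t) = bregman b b1 s t.
  move=> Ts Tt; have [i e] := pm _ s Ts (memb s Ts).
  exact: (KL_bregman (memb s Ts) (memb t Tt) i e).
have breg0 s t : Theta s -> Theta t -> 0 <= bregman b b1 s t.
  exact: (bregman_ge0 iT bb1 b1b2 b2pos).
have lemono := slope_le_mono iT b1b2 b2pos.
have ltmono := slope_lt_mono iT b1b2 b2pos.
split.
- move=> _ _ /meansE[s Ts ->] /meansE[t Tt ->] y /= sy.
  by have [u Tu <-] := slope_IVT iT b1b2 b2pos Ts Tt sy; exact: means_b1.
- by move=> _ /meansE[s Ts ->]; rewrite klE// bregmanxx.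
- by move=> _ _ /meansE[s Ts ->] /meansE[t Tt ->]; rewrite klE// breg0.
- move=> _ _ /meansE[s Ts ->] /meansE[t Tt ->]; rewrite ltmono ?inE// => st.
  by rewrite klE// (bregman_gt0 iT bb1 b1b2 b2pos)// lt_eqF.
- move=> _ _ _ /meansE[s Ts ->] /meansE[u Tu ->] /meansE[t Tt ->].
  move=> /andP[su ut]; rewrite !klE// (bregman_cosines _ _ s u t) lerDl.
  by rewrite mulr_ge0 ?subr_ge0//; rewrite lemono ?inE in ut.
- move=> _ _ _ /meansE[s Ts ->] /meansE[u Tu ->] /meansE[t Tt ->].
  move=> /andP[tu us]; rewrite !klE// (bregman_cosines _ _ s u t) lerDl.
  by rewrite mulr_le0 ?subr_le0//; rewrite lemono ?inE in tu.
- move=> _ _ c /meansE[s Ts ->] /meansE[t Tt ->] st; rewrite klE// => c0.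
  rewrite ltmono ?inE// in st.
  have [u sut <-] := bregman_IVT iT bb1 b1b2 Ts Tt st c0.
  have Tu : Theta u by exact: (iT _ _ Ts Tt).
  exists (b1 u); rewrite klE//; split => //; first exact: means_b1.
  by rewrite !lemono ?inE.
- move=> nu _ [s Ts Ps] /meansE[t Tt ->]; rewrite (pmean nu s)//.
  (* Tilting by [t - s] carries the parameter of [nu] to that of [x]; centring at [x] leaves minus
     the Bregman divergence as exponent. *)
  exists (t - s); split.
  + by rewrite lemono ?inE// subr_le0.
  + by rewrite lemono ?inE// subr_ge0.
  transitivity (\int[nu]_x (expR (x * (t - s) + (- ((t - s) * b1 t))))%:E)%E.
    by apply: eq_integral => x _; congr (expR _)%:E; ring.
  rewrite (member_mgf_shift finZ _ Ts Tt Ps) klE// /bregman; congr (expR _)%:E.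
  by move: (b s) (b t) (b1 t) => u v w; ring.
- move=> D _ _ x y /meansE[lo Tlo ->] /meansE[hi Thi ->] VD xlh ylh.
  have [s Ts sE] := slope_IVT iT b1b2 b2pos Tlo Thi xlh.
  have [t Tt tE] := slope_IVT iT b1b2 b2pos Tlo Thi ylh.
  rewrite -sE -tE !lemono ?inE// in xlh ylh *.
  rewrite klE//; apply: (bregman_quadratic iT bb1 b1b2 b2pos Tlo Thi) => //.
  move=> u /andP[lou uhi].
  have Tu : Theta u by apply: (iT _ _ Tlo Thi); rewrite !ltW.
  (* [member_var] asks for parameters at equal distance on both sides of [u]; the open interval
     leaves room for them. *)
  pose h := Num.min (u - lo) (hi - u).
  have h0 : 0 < h by rewrite lt_min !subr_gt0 lou.
  have hlo : h <= u - lo by rewrite ge_min lexx.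
  have hhi : h <= hi - u by rewrite ge_min lexx orbT.
  have T1 : Theta (u - h) by apply: (iT _ _ Tlo Thi); apply/andP; split; lra.
  have T2 : Theta (u + h) by apply: (iT _ _ Tlo Thi); apply/andP; split; lra.
  apply: le_trans (VD (b1 u) _); last by rewrite !ltmono ?inE// lou.
  exact: (member_var finZ iT bb1 b1b2 h0 T1 T2 (memb u Tu)).
Qed.

End expfam_geometry.

(** * Bandit processes *)

Section conditional_product.
Local Open Scope ereal_scope.
Context d (T : measurableType d) (R : realType) (P : probability T R).

Lemma ge0_integral_mrestr (D : set T) (mD : measurable D) (f : T -> \bar R) :
  measurable_fun setT f -> (forall x, 0 <= f x) ->
  \int[mrestr P mD]_x f x = \int[P]_(x in D) f x.
Proof.
move=> mf f0.
rewrite (@ge0_integral_density _ _ _ P (mrestr P mD) (\1_D : T -> R))//.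
- rewrite [RHS]integral_mkcond; apply: eq_integral => x _.
  by rewrite patchE indicE; case: (x \in D); rewrite ?mule1 ?mule0.
- by move=> A mA; rewrite integral_indic// setIC.
Qed.

(** By the last hypothesis, the image under [X] of [P] restricted to [D] is [nu] scaled by [P D]. *)
Lemma ge0_integral_indep_event (D : set T) (X : T -> measurableTypeR R) (nu : law R)
    (g : measurableTypeR R -> \bar R) : measurable D -> measurable_fun setT X ->
  measurable_fun [set: measurableTypeR R] g -> (forall x, 0 <= g x) ->
  (forall B : set (measurableTypeR R), measurable B ->
     P (D `&` X @^-1` B) = P D * nu B) ->
  \int[P]_(x in D) g (X x) = P D * \int[nu]_x g x.
Proof.
move=> mD mX mg g0 ind.
rewrite -(ge0_integral_mrestr mD)//; last exact: (measurableT_comp mg mX).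
have -> : \int[mrestr P mD]_x g (X x) = \int[pushforward (mrestr P mD) X]_x g x.
  by rewrite ge0_integral_pushforward// => y _; exact: g0.
have PD : (0 <= fine (P D))%R by rewrite fine_ge0.
have PDE : P D = (fine (P D))%:E by rewrite fineK// fin_num_measure.
transitivity (\int[mscale (NngNum PD) nu]_x g x); last first.
  by rewrite ge0_integral_mscale//= -PDE.
apply: (@eq_measure_integral _ _ _ setT (mscale (NngNum PD) nu)
  (measure_function_pushforward__canonical__measure_function_Measure (mrestr P mD) mX)).
move=> B mB _; rewrite /= /pushforward /mrestr setIC ind//.
by rewrite /mscale/= -PDE.
Qed.

(** Reweighting [P] on [E] by [g (X x)] does not change the image under [Y], since [g] has [nu]-mean
    one and [X] is independent of [Y] on [E]; both integrals are therefore the same integral over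
    the image. No joint law of [Y] and [X] is formed. *)
Lemma ge0_integral_indep_prod (E : set T) (Y X : T -> measurableTypeR R) (nu : law R)
    (g : measurableTypeR R -> R) :
  measurable E -> measurable_fun setT Y -> (forall x, (0 <= Y x)%R) ->
  measurable_fun setT X ->
  measurable_fun [set: measurableTypeR R] g -> (forall x, (0 <= g x)%R) ->
  \int[nu]_x (g x)%:E = 1 ->
  (forall A B : set (measurableTypeR R), measurable A -> measurable B ->
     P (E `&` Y @^-1` A `&` X @^-1` B) = P (E `&` Y @^-1` A) * nu B) ->
  \int[P]_(x in E) (Y x * g (X x))%:E = \int[P]_(x in E) (Y x)%:E.
Proof.
move=> mE mY Y0 mX mg g0 g1 ind.
have mYA (A : set (measurableTypeR R)) : measurable A -> measurable (Y @^-1` A).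
  by move=> mA; rewrite -[X in measurable X]setTI; exact: mY.
pose f x : \bar R := (g (X x))%:E.
have mf : measurable_fun setT f by apply/measurable_EFinP; exact: (measurableT_comp mg mX).
have f0 x : 0 <= f x by rewrite lee_fin.
have mYE : measurable_fun setT (EFin \o Y) by exact/measurable_EFinP.
have mrs : measurable_fun setT (fun x => (Y x * g (X x))%:E).
  by apply/measurable_EFinP; apply: measurable_funM => //; exact: (measurableT_comp mg mX).
rewrite -(ge0_integral_mrestr mE mrs); last by move=> x; rewrite lee_fin mulr_ge0.
rewrite -(ge0_integral_mrestr mE mYE); last by move=> x; rewrite lee_fin.
set mu := mrestr P mE.
pose k (A : set T) : \bar R := \int[mu]_(x in A) f x.
have k0 : k set0 = 0 by rewrite /k integral_set0.
have k_ge0 A : 0 <= k A by exact: integral_ge0.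
have k_sigma : semi_sigma_additive k by exact: semi_sigma_additive_nng_induced.
pose kM := isMeasure.Build _ _ _ k k0 k_ge0 k_sigma.
pose kap : {measure set T -> \bar R} := HB.pack k kM.
have := @ge0_integral_density _ _ _ mu kap (fun x => g (X x))
  (measurableT_comp mg mX) (fun x => g0 _) (fun A _ => erefl) (EFin \o Y) mYE.
move=> /(_ (fun x => Y0 x)) /= <-.
(* The change of variables wants an integrand nonnegative on the whole line, so the identity is
   replaced by the absolute value, equal to it on the values of [Y]. *)
have nng : {in [set: measurableTypeR R], forall y, 0 <= `|y|%:E :> \bar R}.
  by move=> y _; rewrite lee_fin.
have mabs : measurable_fun [set: measurableTypeR R]
    (fun y : measurableTypeR R => `|y|%:E : \bar R).
  by apply/measurable_EFinP; exact: normr_measurable.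
have YE x : (Y x)%:E = `|Y x|%:E by rewrite (ger0_norm (Y0 x)).
transitivity (\int[kap]_x (Y x)%:E); first by [].
transitivity (\int[kap]_x `|Y x|%:E); first by apply: eq_integral => x _; exact: YE.
transitivity (\int[mu]_x `|Y x|%:E); last by apply: eq_integral => x _; rewrite YE.
have h1 := ge0_integral_pushforward mY kap measurableT mabs nng.
have h2 := ge0_integral_pushforward mY mu measurableT mabs nng.
rewrite /comp preimage_setT in h1 h2.
rewrite -h1 -h2.
apply: (@eq_measure_integral _ _ _ setT
  (measure_function_pushforward__canonical__measure_function_Measure mu mY)
  (measure_function_pushforward__canonical__measure_function_Measure kap mY)).
move=> A mA _; rewrite /= /pushforward /kap/= /k.
have mYA' := mYA A mA.
rewrite integral_mkcond ge0_integral_mrestr; last 2 first.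
- exact: (measurable_restrictT _ _).1 (measurable_funTS mf).
- by move=> x; apply: erestrict_ge0.
rewrite -integral_mkcondr.
have mgE : measurable_fun [set: measurableTypeR R] (EFin \o g) by exact/measurable_EFinP.
have := @ge0_integral_indep_event (E `&` Y @^-1` A) X nu (EFin \o g)
  (measurableI _ _ mE mYA') mX mgE (fun x => g0 x) (fun B mB => ind A B mA mB).
rewrite /f /= => ->.
by rewrite g1 mule1 /mu /mrestr setIC.
Qed.

End conditional_product.

Section lower_integral.
Local Open Scope ereal_scope.
Context d (T : measurableType d) (R : realType) (P : {measure set T -> \bar R}).

Import HBNNSimple.

(* [f] and [g] need not be measurable, since no measurability of the policy is
   available: only the definition of the integral as a supremum over simple
   functions is used. *)
Lemma ge0_le_integral_ae_scale (D N : set T) (f g : T -> \bar R) (c : R) :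
  (0 < c)%R -> measurable N -> P N = 0 ->
  (forall x, 0 <= f x) -> (forall x, 0 <= g x) ->
  (forall x, D x -> ~ N x -> f x <= c%:E * g x) ->
  \int[P]_(x in D) f x <= c%:E * \int[P]_(x in D) g x.
Proof.
move=> c0 mN PN f0 g0 fg.
rewrite ge0_integralE//; apply: ge_ereal_sup => _ [h hf <-].
rewrite ge0_integralE//.
have ci0 : (0 <= c^-1)%R by rewrite invr_ge0 ltW.
(* A simple function below [f], divided by [c] and set to 0 on the null set [N], is a simple
   function below [g]. *)
pose h' := scale_nnsfun (mul_nnsfun h (indic_nnsfun R (measurableC mN))) ci0.
have h'E x : h' x = (c^-1 * (h x * \1_(~` N) x))%R by [].
have -> : sintegral P h = c%:E * sintegral P h'.
  rewrite -!integralT_nnsfun -ge0_integralZl//; last 3 first.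
  - exact/measurable_EFinP.
  - by move=> x _; rewrite lee_fin.
  - by rewrite lee_fin ltW.
  apply: ge0_ae_eq_integral => //.
  - exact/measurable_EFinP.
  - by apply: emeasurable_funM => //; exact/measurable_EFinP.
  - by move=> x _; rewrite lee_fin.
  - by move=> x _; rewrite mule_ge0 ?lee_fin// ltW.
  exists N; split => // x /= nx; apply: contrapT => Nx; apply: nx => _.
  suff hE : h x = (c * (c^-1 * (h x * \1_(~` N) x)))%R by exact: (congr1 EFin hE).
  by rewrite mulrA divff ?gt_eqF// mul1r indicE mem_set// mulr1.
rewrite lee_pmul2l//.
apply: ereal_sup_ubound; exists h' => //= x.
suff : (c^-1 * (h x * \1_(~` N) x))%:E <= (g \_ D) x by [].
have gD0 : 0 <= (g \_ D) x by exact: erestrict_ge0.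
rewrite indicE; have [/set_mem Nx|Nx] := boolP (x \in ~` N); last by rewrite !mulr0.
rewrite mulr1 EFinM lee_pdivrMl//; move: (hf x); rewrite !patchE.
by case: ifPn => [/set_mem Dx /le_trans|_]; [apply; exact: fg|rewrite mule0].
Qed.

End lower_integral.

(** * Histories, pull counts and likelihood martingales *)

Section bandit_process.
Context (R : realType) (K : nat) (disp : measure_display)
  (Omega : measurableType disp) (P : probability Omega R) (nu : 'I_K -> law R)
  (T : nat) (I : nat -> Omega -> 'I_K) (r : nat -> Omega -> R) (pi : policy R K).
Hypothesis run : bandit_run P nu T I r pi.

Local Notation hist := (history I r).
Local Notation HE := (history_events I r).

Definition arm_count t a w : nat := pulls (hist t w) a.

Definition arm_sum t a w : R := \sum_(x <- hist t w | x.1 == a) x.2.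

Definition history_generators t : set (set Omega) :=
  [set A | exists2 s, (1 <= s <= t)%N &
    (exists a, A = I s @^-1` [set a]) \/
    (exists2 B : set (measurableTypeR R), measurable B & A = r s @^-1` B)].

(** [Omega] with the sigma-algebra [history_events t], so that being adapted to the first [t] rounds
    is plain measurability on this type. *)
Definition past_space t : Type := g_sigma_algebraType (history_generators t).

HB.instance Definition _ t := Measurable.on (past_space t).

Lemma historyS t w : hist t.+1 w = rcons (hist t w) (I t.+1 w, r t.+1 w).
Proof. by rewrite /history -[X in iota _ X]addn1 iotaD map_cat/= add1n cats1. Qed.

Lemma size_history t w : size (hist t w) = t.
Proof. by rewrite size_map size_iota. Qed.

Lemma arm_count0 a w : arm_count 0 a w = 0%N.
Proof. by []. Qed.

Lemma arm_sum0 a w : arm_sum 0 a w = 0.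
Proof. by rewrite /arm_sum big_nil. Qed.

Lemma arm_countS t a w :
  arm_count t.+1 a w = (arm_count t a w + (I t.+1 w == a))%N.
Proof. by rewrite /arm_count /pulls historyS -cats1 count_cat/= addn0. Qed.

Lemma arm_sumS t a w :
  arm_sum t.+1 a w = arm_sum t a w + (I t.+1 w == a)%:R * r t.+1 w.
Proof.
rewrite /arm_sum historyS -cats1 big_cat/= big_cons big_nil/=.
by case: eqP => _; rewrite ?mul1r ?mul0r ?addr0.
Qed.

Lemma arm_count_homo a w : {homo (fun t => arm_count t a w) : s t / (s <= t)%N}.
Proof. by apply: homo_leq => // [|t]; [exact: leq_trans|rewrite arm_countS leq_addr]. Qed.

Lemma arm_count_le t a w : (arm_count t a w <= t)%N.
Proof. by rewrite -[leqRHS](size_history t w) count_size. Qed.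

Lemma history_events_measurable t A : (t <= T)%N -> HE t A -> measurable A.
Proof.
move=> tT; apply: smallest_sub; first exact: sigma_algebra_measurable.
move=> _ [s /andP[s1 st]] [[a ->]|[B mB ->]].
  by apply: (run_arm_measurable run); rewrite s1 (leq_trans st).
rewrite -[X in measurable X]setTI.
by apply: (run_reward_measurable run) => //; rewrite s1 (leq_trans st).
Qed.

Lemma measurable_past_arm t s a : (1 <= s <= t)%N ->
  measurable (I s @^-1` [set a] : set (past_space t)).
Proof. by move=> st; apply: sub_sigma_algebra; exists s => //; left; exists a. Qed.

Lemma measurable_past_reward t s : (1 <= s <= t)%N ->
  measurable_fun [set: past_space t] (r s : past_space t -> measurableTypeR R).
Proof.
move=> st _ B mB; rewrite setTI.
by apply: sub_sigma_algebra; exists s => //; right; exists B.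
Qed.

Lemma measurable_past_indic t s a : (1 <= s <= t)%N ->
  measurable_fun [set: past_space t]
    (fun w => (I s w == a)%:R : measurableTypeR R).
Proof.
move=> st; have -> : (fun w => (I s w == a)%:R : measurableTypeR R) =
    \1_(I s @^-1` [set a]).
  apply/funext => w; rewrite indicE; congr (nat_of_bool _)%:R.
  by apply/eqP/idP => [sa|/set_mem]; [rewrite inE|].
exact: measurable_indic (measurable_past_arm a st).
Qed.

Lemma measurable_arm_count t s a : (s <= t)%N ->
  measurable_fun [set: past_space t]
    (fun w => (arm_count s a w)%:R : measurableTypeR R).
Proof.
elim: s => [_|s IHs st]; first exact: measurable_cst.
under eq_fun do rewrite arm_countS natrD.
by apply: measurable_funD; [exact: (IHs (ltnW st))|exact: measurable_past_indic].
Qed.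

Lemma measurable_arm_sum t s a : (s <= t)%N ->
  measurable_fun [set: past_space t]
    (arm_sum s a : past_space t -> measurableTypeR R).
Proof.
elim: s => [_|s IHs st].
  by rewrite (_ : arm_sum 0 a = cst 0)//; apply/funext => w; exact: arm_sum0.
rewrite (_ : arm_sum s.+1 a = fun w => arm_sum s a w + (I s.+1 w == a)%:R * r s.+1 w).
  apply: measurable_funD; first exact: (IHs (ltnW st)).
  apply: measurable_funM; first exact: measurable_past_indic.
  exact: measurable_past_reward.
by apply/funext => w; rewrite arm_sumS.
Qed.

Lemma history_events_preimage t (f : past_space t -> measurableTypeR R)
    (B : set (measurableTypeR R)) :
  measurable_fun setT f -> measurable B -> HE t (f @^-1` B).
Proof. by move=> mf mB; rewrite -[X in HE t X]setTI; exact: mf. Qed.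

Lemma history_events_count t a k : HE t [set w | arm_count t a w = k].
Proof.
rewrite (_ : [set w | _] = (fun w => (arm_count t a w)%:R : R) @^-1` [set k%:R]).
  exact: (history_events_preimage (measurable_arm_count a (leqnn t))
    (measurable_set1 (k%:R : R))).
apply/seteqP; split => w /=; first by move=> ->.
by move/eqP; rewrite eqr_nat => /eqP.
Qed.

Lemma history_events_count_lt t a k : HE t [set w | (arm_count t a w < k)%N].
Proof.
rewrite (_ : [set w | _] = (fun w => (arm_count t a w)%:R : R) @^-1` `]-oo, k%:R[).
  exact: (history_events_preimage (measurable_arm_count a (leqnn t))
    (measurable_itv `]-oo, (k%:R : R)[)).
by apply/seteqP; split => w /=; rewrite in_itv/= ltr_nat.
Qed.

Lemma history_events_emp_mean t a (B : set (measurableTypeR R)) :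
  measurable B -> HE t [set w | B (emp_mean (hist t w) a)].
Proof.
apply: history_events_preimage.
apply: measurable_funM; first exact: measurable_arm_sum.
under eq_fun do rewrite -powR_inv1 ?ler0n//.
exact: (measurableT_comp (measurable_powR (-1)) (measurable_arm_count a (leqnn t))).
Qed.

Lemma history_eventsI t A B : HE t A -> HE t B -> HE t (A `&` B).
Proof. exact: (@measurableI _ (past_space t) A B). Qed.

Lemma history_eventsD t A B : HE t A -> HE t B -> HE t (A `\` B).
Proof. exact: (@measurableD _ (past_space t) A B). Qed.

Section stopped_likelihood.
Variables (a : 'I_K) (k : nat) (g : measurableTypeR R -> R).
Hypotheses (mg : measurable_fun [set: measurableTypeR R] g) (g0 : forall x, 0 <= g x).
Hypothesis g1 : (\int[nu a]_x (g x)%:E = 1)%E.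

(* A martingale, constant after the [k]-th pull of [a]. *)
Fixpoint stopped_likelihood t w : R :=
  if t is s.+1 then
    stopped_likelihood s w *
      (if (I t w == a) && (arm_count s a w < k)%N then g (r t w) else 1)
  else 1.

Lemma stopped_likelihood_ge0 t w : 0 <= stopped_likelihood t w.
Proof. by elim: t => [//|t IHt] /=; rewrite mulr_ge0//; case: ifP. Qed.

Lemma measurable_stopped_likelihood t s : (s <= t)%N ->
  measurable_fun [set: past_space t]
    (stopped_likelihood s : past_space t -> measurableTypeR R).
Proof.
elim: s => [_|s IHs st].
  by rewrite (_ : stopped_likelihood 0 = cst 1).
pose lt_k : past_space t -> R := \1_((fun w => (arm_count s a w)%:R : R) @^-1` `]-oo, k%:R[).
rewrite (_ : stopped_likelihood s.+1 = fun w => stopped_likelihood s w *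
    (1 + (I s.+1 w == a)%:R * lt_k w * (g (r s.+1 w) - 1))).
  apply: measurable_funM; first exact: (IHs (ltnW st)).
  apply: measurable_funD; first exact: measurable_cst.
  apply: measurable_funM.
    apply: measurable_funM; first exact: measurable_past_indic.
    apply: measurable_indic; rewrite -[X in measurable X]setTI.
    exact: (measurable_arm_count a (ltnW st)).
  apply: measurable_funB; last exact: measurable_cst.
  exact: (measurableT_comp mg (measurable_past_reward _)).
apply/funext => w; rewrite /lt_k /= indicE; congr (_ * _).
have -> : (w \in (fun w => (arm_count s a w)%:R : R) @^-1` `]-oo, k%:R[) =
    (arm_count s a w < k)%N.
  by apply/idP/idP => [/set_mem|h]; [|apply/mem_set]; rewrite /= in_itv/= ltr_nat.
by case: (_ == a); case: (_ < k)%N => /=; ring.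
Qed.

(** The last factor differs from 1 only on the event [E] that [a] is pulled after fewer than [k]
    pulls. On [E] the new reward has law [nu a] given the past, and [g] has mean one under it. *)
Lemma integral_stopped_likelihood t : (t <= T)%N ->
  (\int[P]_w (stopped_likelihood t w)%:E = 1)%E.
Proof.
elim: t => [_|t IHt tT].
  have := expectation_cst P 1; rewrite expectation.unlock => e1.
  by rewrite -[RHS]e1; apply: eq_integral.
have meas s : (s <= T)%N ->
    measurable_fun [set: Omega] (stopped_likelihood s : Omega -> measurableTypeR R).
  move=> sT _ B mB; rewrite setTI; apply: (history_events_measurable sT).
  exact: (history_events_preimage (measurable_stopped_likelihood (leqnn s)) mB).
have mE s : (s <= T)%N -> measurable_fun [set: Omega] (fun w => (stopped_likelihood s w)%:E).
  by move=> sT; apply/measurable_EFinP; exact: meas.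
pose H := [set w | (arm_count t a w < k)%N].
have HH : HE t H by exact: history_events_count_lt.
have mIa : measurable (I t.+1 @^-1` [set a]) by exact: (run_arm_measurable run).
pose E := H `&` I t.+1 @^-1` [set a].
have mEE : measurable E.
  by apply: measurableI => //; exact: (history_events_measurable (ltnW tT)).
have split_int s : (s <= T)%N -> (\int[P]_w (stopped_likelihood s w)%:E =
    \int[P]_(w in E) (stopped_likelihood s w)%:E +
    \int[P]_(w in ~` E) (stopped_likelihood s w)%:E)%E.
  move=> sT; rewrite -ge0_integral_setU//.
  - by rewrite setUv.
  - exact: measurableC.
  - by rewrite setUv; exact: mE.
  - by move=> w _; rewrite lee_fin stopped_likelihood_ge0.
  - by apply/disj_setPS; rewrite setICr.
rewrite -(IHt (ltnW tT)) !split_int ?(ltnW tT)//; congr (_ + _)%E; last first.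
  apply: eq_integral => w /set_mem nE /=.
  case: ifP => [/andP[/eqP Ia lk]|_]; last by rewrite mulr1.
  by exfalso; apply: nE; split.
transitivity (\int[P]_(w in E) (stopped_likelihood t w * g (r t.+1 w))%:E)%E.
  by apply: eq_integral => w /set_mem [/= h1 h2]; rewrite h2 eqxx h1.
apply: (@ge0_integral_indep_prod _ _ R P E _ (r t.+1) (nu a) g) => //.
- exact: meas (ltnW tT).
- by move=> w; exact: stopped_likelihood_ge0.
- exact: (run_reward_measurable run).
- move=> A B mA mB; rewrite /E.
  have HA : HE t (H `&` stopped_likelihood t @^-1` A).
    apply: (@measurableI _ (past_space t)) => //.
    exact: (history_events_preimage (measurable_stopped_likelihood (leqnn t)) mA).
  have := run_reward run a tT HA mB.
  by rewrite [H `&` I _ @^-1` _ `&` _]setIAC.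
Qed.

Lemma stopped_likelihood_stop s t w : (s <= t)%N -> (k <= arm_count s a w)%N ->
  stopped_likelihood t w = stopped_likelihood s w.
Proof.
move=> st ks; elim: t st => [|t IHt]; first by rewrite leqn0 => /eqP ->.
rewrite leq_eqVlt => /predU1P[->//|]; rewrite ltnS => st.
by rewrite /= ltnNge (leq_trans ks (arm_count_homo a w st)) andbF mulr1 IHt.
Qed.

End stopped_likelihood.

Lemma stopped_likelihood_expR a k l x q t w : (arm_count t a w <= k)%N ->
  stopped_likelihood a k (fun y => expR (l * (y - x) + q)) t w =
  expR (l * (arm_sum t a w - (arm_count t a w)%:R * x) + (arm_count t a w)%:R * q).
Proof.
elim: t => [_|t IHt]; first by rewrite arm_sum0 arm_count0 !mul0r subrr mulr0 addr0 expR0.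
rewrite arm_countS arm_sumS /=; case: eqP => Ia /=; last first.
  by rewrite addn0 mul0r addr0 mulr1 => /IHt.
rewrite addn1 => tk; rewrite tk IHt ?(ltnW tk)// -expRD mul1r -natr1.
by congr expR; move: (arm_count t a w)%:R (arm_sum t a w) => n s; ring.
Qed.

(** Markov's inequality for the likelihood at time [T]. As it is frozen from the [k]-th pull on, a
    single event serves all rounds at which the count is [k], with no union bound over time. *)
Lemma arm_chernoff a k l x q :
  (\int[nu a]_y (expR (l * (y - x) + q))%:E = 1)%E ->
  exists2 C : set Omega, measurable C & (P C <= (expR (- (k%:R * q)))%:E)%E /\
    forall t w, (t <= T)%N -> arm_count t a w = k ->
      0 <= l * (arm_sum t a w - k%:R * x) -> C w.
Proof.
pose g (y : measurableTypeR R) : R := expR (l * (y - x) + q); move=> g1.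
have mg : measurable_fun [set: measurableTypeR R] (g : measurableTypeR R -> R).
  apply: measurableT_comp => //; apply: measurable_funD => //.
  by apply: measurable_funM => //; exact: measurable_funB.
have g0 y : 0 <= g y by exact: expR_ge0.
pose L := stopped_likelihood a k g T.
have mL : measurable_fun [set: Omega] (L : Omega -> measurableTypeR R).
  move=> _ B mB; rewrite setTI; apply: (history_events_measurable (leqnn T)).
  exact: (history_events_preimage (measurable_stopped_likelihood a k mg (leqnn T)) mB).
pose c := expR (k%:R * q); have c0 : 0 < c by exact: expR_gt0.
pose C := [set w | c <= L w].
have mC : measurable C.
  rewrite (_ : C = L @^-1` `[c, +oo[).
    by rewrite -[X in measurable X]setTI; exact: mL.
  by apply/seteqP; split => w /=; rewrite in_itv/= andbT.
exists C => //; split.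
- have h : (c%:E * P C <= 1)%E.
    rewrite -(integral_stopped_likelihood k mg g0 g1 (leqnn T)).
    rewrite -/L -(setIT C) -integral_indic// -ge0_integralZl//; last 2 first.
    + exact/measurable_EFinP.
    + by rewrite lee_fin ltW.
    apply: ge0_le_integral => //.
    + by move=> w _; apply: mule_ge0; rewrite lee_fin// ltW.
    + by apply: emeasurable_funM => //; exact/measurable_EFinP.
    + exact/measurable_EFinP.
    move=> w _; rewrite -EFinM lee_fin indicE; have [/set_mem cw|_] := boolP (w \in C).
      by rewrite mulr1.
    by rewrite mulr0 stopped_likelihood_ge0.
  by rewrite expRN -/c -[leRHS]mule1 lee_pdivlMl.
- move=> t w tT ck h; rewrite /C/= /L (stopped_likelihood_stop _ tT) ?ck//.
  rewrite stopped_likelihood_expR ?ck// ler_expR lerDr//.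
Qed.

End bandit_process.

(** * Covers and disjoint unions of events *)

Section finite_unions.
Local Open Scope ereal_scope.
Context d (T : measurableType d) (R : realType) (P : probability T R).

Lemma measure_cover_null n (A N : set T) (B : nat -> set T) :
  measurable A -> measurable N -> P N = 0 ->
  (forall i, (i < n)%N -> measurable (B i)) ->
  (forall x, A x -> ~ N x -> exists2 i, (i < n)%N & B i x) ->
  P A <= \sum_(i < n) P (B i).
Proof.
move=> mA mN PN mB cov.
pose B' i := if i is j.+1 then B j else N.
have : P A <= \sum_(i < n.+1) P (B' i).
  apply: content_subadditive => //.
  - by case=> [_|i /=]; [exact: mN|rewrite ltnS; exact: mB].
  - rewrite -bigcup_mkord => x Ax; have [Nx|/(cov x Ax)[i lin Bix]] := pselect (N x).
      by exists 0%N.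
    by exists i.+1.
by rewrite big_ord_recl/= PN add0e.
Qed.

Lemma sum_measure_disjoint n (A : nat -> set T) (C : set T) :
  (forall i, (i < n)%N -> measurable (A i)) -> measurable C ->
  (forall i j x, (i < j < n)%N -> A i x -> A j x -> False) ->
  (forall i x, (i < n)%N -> A i x -> C x) ->
  \sum_(i < n) P (A i) <= P C.
Proof.
move=> mA mC dis sub.
have mA' (i : 'I_n) : measurable (A i) by exact: mA.
rewrite -(@measure_bigsetU_ord _ _ _ P n xpredT (fun i : 'I_n => A i))//.
  apply: le_measure; rewrite ?inE//; first exact: bigsetU_measurable.
  by rewrite -(bigcup_mkord n A) => x [i /= iltn]; exact: sub.
apply/trivIsetP => i j _ _ ij; rewrite -subset0 => x [Ai Aj].
move: ij; rewrite neq_ltn => /orP[ij|ji].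
- by apply: (dis i j x) => //; rewrite ij/=.
- by apply: (dis j i x) => //; rewrite ji/=.
Qed.

End finite_unions.

Section finite_sup.
Context (R : realType) (K : nat) (f : 'I_K -> R).

Lemma le_sup_range a : f a <= sup (range f).
Proof.
apply: ub_le_sup; last by exists a.
exists (\sum_b `|f b|) => _ [b _ <-].
by rewrite (bigD1 b)//= ler_wpDr ?ler_norm// sumr_ge0.
Qed.

Lemma sup_range_attained : (0 < K)%N -> exists a, sup (range f) = f a.
Proof.
move=> K0; pose a0 := Ordinal K0.
case: (@arg_maxP _ _ _ a0 xpredT f isT) => a _ amax.
exists a; apply/eqP; rewrite eq_le le_sup_range andbT.
apply: ge_sup; first by exists (f a), a.
by move=> _ [b _ <-]; exact: amax.
Qed.

End finite_sup.

(** * Pull probabilities and decomposition of the regret *)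

Section bandit_bounds.
Context (R : realType) (K : nat) (disp : measure_display)
  (Omega : measurableType disp) (P : probability Omega R) (nu : 'I_K -> law R)
  (T : nat) (I : nat -> Omega -> 'I_K) (r : nat -> Omega -> R) (pi : policy R K).
Hypothesis run : bandit_run P nu T I r pi.

Local Notation hist := (history I r).
Local Notation HE := (history_events I r).
Local Notation pull t a := (I t.+1 @^-1` [set a]).

Lemma measurable_pull t a : (t < T)%N -> measurable (pull t a).
Proof. by move=> tT; exact: (run_arm_measurable run). Qed.

Lemma history_pull_measurable t a H : (t < T)%N -> HE t H ->
  measurable (H `&` pull t a).
Proof.
move=> tT HH; apply: measurableI; last exact: measurable_pull.
exact: (history_events_measurable run (ltnW tT)).
Qed.

(** A pull of [a] raises its count, so it happens at count [k] in at most one round: the events are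
    disjoint in [t]. *)
Lemma sum_pull_le a k (H : nat -> set Omega) (C : set Omega) :
  (forall t, (t < T)%N -> HE t (H t)) -> measurable C ->
  (forall t w, (t < T)%N -> H t w -> arm_count I r t a w = k) ->
  (forall t w, (t < T)%N -> H t w -> C w) ->
  (\sum_(t < T) P (H t `&` pull t a) <= P C)%E.
Proof.
move=> HH mC Hk HC; apply: (@sum_measure_disjoint _ _ _ _ _ (fun t => H t `&` pull t a)) => //.
- by move=> t tT; apply: history_pull_measurable => //; exact: HH.
- move=> s t w /andP[st tT] [Hs /= Is] [Ht _].
  have sT := ltn_trans st tT.
  have := arm_count_homo I r a w st; rewrite arm_countS Is eqxx.
  by rewrite (Hk s w sT Hs) (Hk t w tT Ht) addn1 ltnn.
- by move=> t w tT [/(HC t w tT)].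
Qed.

Lemma run_arm_compare t a a' H (N : set Omega) (c : R) : (t < T)%N -> HE t H ->
  0 < c -> measurable N -> P N = 0%E -> (forall h b, 0 <= pi h b) ->
  (forall w, H w -> ~ N w -> pi (hist t w) a <= c * pi (hist t w) a') ->
  (P (H `&` pull t a) <= c%:E * P (H `&` pull t a'))%E.
Proof.
move=> tT HH c0 mN PN pi0 pic; rewrite !(run_arm run _ tT HH).
apply: (ge0_le_integral_ae_scale c0 mN PN).
- by move=> w; rewrite lee_fin.
- by move=> w; rewrite lee_fin.
- by move=> w Hw Nw; rewrite -EFinM lee_fin; exact: pic.
Qed.

Lemma run_arm_le t a H (N : set Omega) (c : R) : (t < T)%N -> HE t H ->
  0 < c -> measurable N -> P N = 0%E -> (forall h b, 0 <= pi h b) ->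
  (forall w, H w -> ~ N w -> pi (hist t w) a <= c) ->
  (P (H `&` pull t a) <= c%:E)%E.
Proof.
move=> tT HH c0 mN PN pi0 pic; rewrite (run_arm run _ tT HH).
have mH := history_events_measurable run (ltnW tT) HH.
have /le_trans : (\int[P]_(w in H) (pi (hist t w) a)%:E <=
    c%:E * \int[P]_(w in H) cst 1%E w)%E.
  apply: (ge0_le_integral_ae_scale c0 mN PN).
  - by move=> w; rewrite lee_fin.
  - by move=> w /=; rewrite lee_fin.
  - by move=> w Hw Nw /=; rewrite mule1 lee_fin; exact: pic.
apply; rewrite integral_cst// mul1e.
by rewrite -[leRHS]mule1 lee_pmul2l// probability_le1.
Qed.

Lemma regretE : regret P nu T I =
  (\sum_a (mu_max nu - mean (nu a))%:E * \sum_(t < T) P (pull t a))%E.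
Proof.
rewrite /regret expectation.unlock.
pose D a := mu_max nu - mean (nu a).
have D0 a : 0 <= D a by rewrite subr_ge0; exact: (le_sup_range (fun b => mean (nu b))).
have mp (t : 'I_T) a : measurable (pull t a) by exact: measurable_pull.
have md (t : 'I_T) a : measurable_fun [set: Omega]
    (fun w => (D a)%:E * (\1_(pull t a) w)%:E)%E.
  by apply: emeasurable_funM => //; exact/measurable_EFinP.
have d0 (t : 'I_T) a w : (0 <= (D a)%:E * (\1_(pull t a) w)%:E)%E.
  by rewrite mule_ge0 ?lee_fin.
transitivity (\int[P]_w \sum_(t < T) \sum_a (D a)%:E * (\1_(pull t a) w)%:E)%E.
  apply: eq_integral => w _; rewrite big_add1 big_mkord -sumEFin.
  apply: eq_bigr => t _; rewrite (bigD1 (I t.+1 w))//= big1 ?adde0.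
    by rewrite indicE mem_set// mule1.
  move=> b bI; rewrite indicE memNset ?mule0//= => Ib.
  by rewrite Ib eqxx in bI.
rewrite ge0_integral_sum//; last 2 first.
- by move=> t; apply: emeasurable_sum => a; exact: md.
- by move=> t w _; apply: sume_ge0 => a _; exact: d0.
transitivity (\sum_(t < T) \sum_a (D a)%:E * P (pull t a))%E.
  apply: eq_bigr => t _; rewrite ge0_integral_sum//.
  apply: eq_bigr => a _; rewrite ge0_integralZl//.
  - by rewrite integral_indic// setIT.
  - by exact/measurable_EFinP.
  - by rewrite lee_fin.
by rewrite exchange_big/=; apply: eq_bigr => a _; rewrite ge0_sume_distrr.
Qed.

Lemma sum_pulls_le : (\sum_a \sum_(t < T) P (pull t a) <= T%:R%:E)%E.
Proof.
rewrite exchange_big/=; apply: (@le_trans _ _ (\sum_(t < T) 1)%E); last first.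
  by rewrite sumEFin lee_fin sumr_const card_ord.
apply: lee_sum => t _.
rewrite -(@measure_bigsetU_ord _ _ _ P K xpredT (fun a => pull t a)).
- by apply: probability_le1; apply: bigsetU_measurable => a _; exact: measurable_pull.
- by move=> a; exact: measurable_pull.
by apply/trivIsetP => a b _ _ ab; rewrite -subset0 => w [/= -> /eqP]; rewrite (negbTE ab).
Qed.

End bandit_bounds.

(** * Expected number of pulls of a suboptimal arm *)

Section geometric_sums.
Variable R : realType.

Lemma sum_geometric_le (q : R) n : 0 <= q < 1 -> \sum_(j < n) q ^+ j <= (1 - q)^-1.
Proof.
move=> /andP[q0 q1]; have h : 0 < 1 - q by rewrite subr_gt0.
rewrite -[leRHS]mul1r ler_pdivlMr// mulrC.
rewrite -opprB mulNr -subrX1 opprB gerBl exprn_ge0//.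
Qed.

(** The full series is [1 / (expR kap - 1)], and [expR kap >= 1 + kap]. *)
Lemma sum_expR_le (kap : R) n : 0 < kap ->
  \sum_(k < n) expR (- (k.+1%:R * kap)) <= kap^-1.
Proof.
move=> k0; pose q := expR (- kap).
have q0 : 0 <= q by exact: expR_ge0.
have q1 : q < 1 by rewrite -expR0 ltr_expR oppr_lt0.
have -> : \sum_(k < n) expR (- (k.+1%:R * kap)) = q * \sum_(k < n) q ^+ k.
  rewrite mulr_sumr; apply: eq_bigr => k _; rewrite -exprS -expRM_natl.
  by congr expR; rewrite mulrN.
apply: (@le_trans _ _ (q * (1 - q)^-1)).
  by rewrite ler_wpM2l// sum_geometric_le// q0.
rewrite ler_pdivrMr ?subr_gt0// mulrC ler_pdivlMr//.
have : expR kap * q = 1 by rewrite -expRD subrr expR0.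
have := expR_ge1Dx kap; move: (expR kap) => E hE hq.
have : q * (1 + kap) <= q * E by rewrite ler_wpM2l.
by rewrite (mulrC q E) hq mulrDr mulr1; lra.
Qed.

End geometric_sums.

(** * Sampling probabilities and concentration under the policy *)

Section kl_maillard.
Context (R : realType) (K : nat) (disp : measure_display)
  (Omega : measurableType disp) (P : probability Omega R) (nu : 'I_K -> law R)
  (T : nat) (I : nat -> Omega -> 'I_K) (r : nat -> Omega -> R)
  (F : set (law R)) (d : R).
Hypotheses (d1 : 1 < d) (K0 : (0 < K)%N) (geo : kl_geometry F).

Local Notation pi := (general_exp_kl_ms (K := K) F (fun k : nat => k%:R / d)).

Hypotheses (run : bandit_run P nu T I r pi) (empF : emp_means_in P T I r F).
Hypothesis Fnu : forall b, F (nu b).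

Local Notation hist := (history I r).
Local Notation HE := (history_events I r).
Local Notation pull t a := (I t.+1 @^-1` [set a]).
Local Notation count := (arm_count I r).

Let d0 : 0 < d. Proof. exact: lt_trans d1. Qed.

Lemma means_nu b : means F (mean (nu b)).
Proof. by exists (nu b). Qed.

Lemma emp_mean_le_max (h : past R K) b : emp_mean h b <= emp_max h.
Proof. exact: le_sup_range. Qed.

Lemma emp_max_attained (h : past R K) : exists b, emp_max h = emp_mean h b.
Proof. exact: sup_range_attained. Qed.

Definition kl_weight (h : past R K) b : R :=
  expR (- ((pulls h b)%:R / d * KLm F (emp_mean h b) (emp_max h))).

Lemma kl_ms_ge0 h b : 0 <= pi h b.
Proof.
rewrite /general_exp_kl_ms; case: ifP => _; first exact: ler0n.
by rewrite divr_ge0 ?expR_ge0// sumr_ge0// => c _; rewrite expR_ge0.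
Qed.

Lemma kl_msE h b : (K <= size h)%N -> pi h b = kl_weight h b / \sum_c kl_weight h c.
Proof. by rewrite /general_exp_kl_ms ltnNge => ->. Qed.

Lemma sum_kl_weight_gt0 h : 0 < \sum_c kl_weight h c.
Proof.
rewrite (bigD1 (Ordinal K0))//= ltr_pwDl ?expR_gt0// sumr_ge0// => c _.
exact: expR_ge0.
Qed.

(** An arm with the largest empirical mean has weight 1, so the normalizer is at least 1. *)
Lemma kl_ms_le h b : (K <= size h)%N -> (forall c, means F (emp_mean h c)) ->
  pi h b <= kl_weight h b.
Proof.
move=> Kh mF; rewrite kl_msE// ler_pdivrMr ?sum_kl_weight_gt0//.
rewrite ler_peMr ?expR_ge0//; have [b' bE] := emp_max_attained h.
rewrite (bigD1 b')//= {1}/kl_weight bE (KLmxx geo)// mulr0 oppr0 expR0.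
by rewrite lerDl sumr_ge0// => c _; exact: expR_ge0.
Qed.

(** The normalizers cancel and the weight of [a] is at most 1. *)
Lemma kl_ms_ratio h a b : (K <= size h)%N -> (forall c, means F (emp_mean h c)) ->
  pi h a <= (kl_weight h b)^-1 * pi h b.
Proof.
move=> Kh mF; rewrite !kl_msE// mulrA mulVf ?gt_eqF ?expR_gt0// mul1r.
rewrite ler_pdivrMr ?sum_kl_weight_gt0// mulVf ?gt_eqF ?sum_kl_weight_gt0//.
rewrite -expR0 ler_expR oppr_le0 mulr_ge0 ?divr_ge0 ?(ltW d0)//.
apply: (KLm_ge0 geo); first exact: mF.
by have [b' ->] := emp_max_attained h; exact: mF.
Qed.

Lemma initial_pull_null t : (t < K)%N -> (t < T)%N ->
  P [set w | I t.+1 w != t :> nat] = 0%E.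
Proof.
move=> tK tT; pose a : 'I_K := Ordinal tK.
have HT : HE t setT by exact: (@measurableT _ (past_space I r t)).
have mp : measurable (pull t a) by exact: (measurable_pull run a tT).
have -> : [set w | I t.+1 w != t :> nat] = ~` pull t a.
  apply/seteqP; split => w /=; first by move=> + Ia; rewrite Ia eqxx.
  by move=> Ia; apply/eqP => It; apply: Ia; exact: val_inj.
rewrite probability_setC//.
have := run_arm run a tT HT; rewrite setTI => ->.
have e1 := expectation_cst P 1; rewrite expectation.unlock in e1.
rewrite (_ : (\int[P]_w _)%E = 1%E) ?subee//.
rewrite -[RHS]e1; apply: eq_integral => w _.
by rewrite /general_exp_kl_ms size_history tK eqxx.
Qed.

(** Gathers the exceptional runs in one null set: both the membership of the empirical means and the
    order of the initial pulls hold only almost surely. *)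
Lemma regular_runs : exists N, [/\ measurable N, P N = 0%E &
  forall w, ~ N w ->
    (forall t a, (1 <= t <= T)%N -> (0 < count t a w)%N ->
       means F (emp_mean (hist t w) a)) /\
    (forall t a, (t <= T)%N -> (t <= K)%N -> count t a w = (a < t)%N :> nat)].
Proof.
pose bad t : set Omega := if (t < K)%N && (t < T)%N
  then [set w | I t.+1 w != t :> nat] else set0.
have bad0 t : P.-negligible (bad t).
  rewrite /bad; case: ifP => [/andP[tK tT]|_]; last exact: negligible_set0.
  exists [set w | I t.+1 w != t :> nat]; split => //; last exact: initial_pull_null.
  rewrite (_ : [set w | _] = ~` pull t (Ordinal tK)).
    by apply: measurableC; exact: (measurable_pull run (Ordinal tK) tT).
  apply/seteqP; split => w /=; first by move=> + Ia; rewrite Ia eqxx.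
  by move=> Ia; apply/eqP => It; apply: Ia; exact: val_inj.
have [N1 [mN1 PN1 sN1]] := empF.
have [N2 [mN2 PN2 sN2]] := negligible_bigcup bad0.
exists (N1 `|` N2); split; first exact: measurableU.
  by rewrite null_set_setU.
move=> w /not_orP[nN1 nN2]; split.
  by move=> t a tT c0; apply: contrapT => nm; apply: nN1; apply: sN1 => /= /(_ t a tT c0).
elim=> [|t IHt] a tT tK; first by rewrite arm_count0 ltn0.
rewrite arm_countS IHt ?(ltnW tT) ?(ltnW tK)//.
have It : I t.+1 w = t :> nat.
  apply: contrapT => /eqP It; apply: nN2; apply: sN2; exists t => //.
  by rewrite /bad tK tT.
by rewrite -val_eqE/= It ltnS; case: (ltngtP t a).
Qed.

(** [arm_chernoff] with the tilt [l] of [KLm_mgf]. The sign of [l] follows the side of [mean (nu b)]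
    on which [u] lies, so one event treats either tail. *)
Lemma chernoff_emp_mean b k u : means F u -> (0 < k)%N ->
  exists2 C : set Omega, measurable C &
    (P C <= (expR (- (k%:R * KLm F u (mean (nu b)))))%:E)%E /\
    forall t w, (t <= T)%N -> count t b w = k ->
      (u <= mean (nu b)) && (emp_mean (hist t w) b <= u) ||
      (mean (nu b) <= u) && (u <= emp_mean (hist t w) b) -> C w.
Proof.
move=> mu k0; have [l [lle lge lint]] := KLm_mgf geo (Fnu b) mu.
have [|C mC [PC hC]] := arm_chernoff run (a := b) k (l := l) (x := u)
    (q := KLm F u (mean (nu b))).
  have e : (\int[nu b]_y (expR (l * (y - u) + KLm F u (mean (nu b))))%:E =
      \int[nu b]_y ((expR (KLm F u (mean (nu b))))%:E * (expR (l * (y - u)))%:E))%E.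
    by apply: eq_integral => y _; rewrite -EFinM -expRD addrC.
  rewrite e ge0_integralZl//; last first.
  - apply/measurable_EFinP; apply: measurableT_comp => //.
    by apply: measurable_funM => //; exact: measurable_funB.
  by rewrite lint -EFinM -expRD subrr expR0.
exists C => //; split => // t w tT ck h; apply: (hC t w tT ck).
have kE : arm_sum I r t b w - k%:R * u = k%:R * (emp_mean (hist t w) b - u).
  rewrite mulrBr /emp_mean -/(arm_count I r t b w) ck [k%:R * (_ / _)]mulrC divfK//.
  by rewrite pnatr_eq0 -lt0n.
rewrite kE mulrCA mulr_ge0//; case/orP : h => /andP[h1 h2].
- by rewrite mulr_le0 ?subr_le0// lle.
- by rewrite mulr_ge0 ?subr_ge0// lge.
Qed.

(** * Pulls of an arm [a] against an arm [a1] of mean at least [y0] *)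

Section arm_bound.
Variables (a a1 : 'I_K) (x2 y0 kap : R).
Hypotheses (mx2 : means F x2) (my0 : means F y0).
Hypotheses (ax2 : mean (nu a) <= x2) (x2y0 : x2 < y0) (y0a1 : y0 <= mean (nu a1)).
Hypotheses (kap0 : 0 < kap) (kap1 : kap <= KLm F x2 y0)
  (kap2 : kap <= KLm F x2 (mean (nu a))) (kap3 : kap <= KLm F y0 (mean (nu a1))).

Definition all_below t : set Omega := [set w | forall b, emp_mean (hist t w) b < y0].

Lemma history_events_all_below t : HE t (all_below t).
Proof.
rewrite (_ : all_below t = \bigcap_(b in [set: 'I_K])
    [set w | `]-oo, y0[%classic (emp_mean (hist t w) b)]).
  apply: (@fin_bigcap_measurable _ (past_space I r t)) => // b _.
  exact: (history_events_emp_mean b (measurable_itv `]-oo, (y0 : R)[)).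
rewrite set_itvE; apply/seteqP; split => w /= h b; first by move=> _; exact: h.
by apply: h.
Qed.

(** Below [y0], the means at divergence at least [c] from [y0] are those up to some [u] with
    [KLm F u y0 = c], and superadditivity gives [KLm F u (mean (nu a1)) >= c + kap]. [DC.1] is this
    half-line and [DC.2] the Chernoff event at [u]. *)
Lemma kl_level c k : 0 <= c -> (0 < k)%N -> exists DC : set R * set Omega,
  [/\ measurable (DC.1 : set (measurableTypeR R)), measurable DC.2,
    (P DC.2 <= (expR (- (k%:R * (c + kap))))%:E)%E,
    forall x, means F x -> x < y0 -> DC.1 x <-> c <= KLm F x y0 &
    forall t w, (t <= T)%N -> count t a1 w = k -> DC.1 (emp_mean (hist t w) a1) -> DC.2 w].
Proof.
move=> c0 k0.
have [[x [mx xy cx]]|none] := pselect (exists x, [/\ means F x, x < y0 & c <= KLm F x y0]).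
  have [|u [mu /andP[xu uy] uc]] := KLm_IVT geo (c := c) mx my0 xy; first by rewrite c0.
  have [C mC [PC hC]] := chernoff_emp_mean a1 mu k0.
  exists (`]-oo, u]%classic, C); split => //=.
  - apply: le_trans PC _; rewrite lee_fin ler_expR lerN2 ler_wpM2l//.
    apply: (@le_trans _ _ (KLm F u y0 + KLm F y0 (mean (nu a1)))).
      by rewrite uc lerD2l.
    by apply: (KLm_superadd_le geo) => //; [exact: means_nu|rewrite uy].
  - move=> z mz zy; rewrite in_itv/=; split=> [zu|cz].
      have := KLm_superadd_le geo mz mu my0; rewrite zu uy uc => /(_ isT).
      by apply: le_trans; rewrite lerDr (KLm_ge0 geo).
    rewrite leNgt; apply/negP => uz.
    have := KLm_superadd_le geo mu mz my0; rewrite (ltW uz) (ltW zy) uc => /(_ isT).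
    have := KLm_gt0 geo mu mz uz; lra.
  - move=> t w tT ck; rewrite in_itv/= => eu; apply: (hC t w tT ck).
    by rewrite eu (le_trans uy).
(* No mean below [y0] reaches the level [c]. *)
exists (set0, set0); split => //=; first by rewrite measure0 lee_fin expR_ge0.
by move=> z mz zy; split => // cz; apply: none; exists z.
Qed.

(** The fraction is the geometric series over the levels [j], with terms
    [expR (j + 1) * expR (- d * j)]; the final 1 pays for the levels from [T] on. *)
Definition explore_cst : R := expR 1 / (1 - expR (- (d - 1))) + 1.

Lemma explore_cst_gt0 : 0 < explore_cst.
Proof.
rewrite ltr_wpDl// divr_ge0 ?expR_ge0// subr_ge0 -[leRHS]expR0 ler_expR oppr_le0.
by rewrite subr_ge0 ltW.
Qed.

(* The events are cut along the levels [j <= k / d * KLm F x y0 < j + 1] of the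
   empirical mean [x] of [a1]; the levels [j >= T] are treated together. *)
Lemma exploration_level N k : measurable N -> P N = 0%E ->
  (forall w, ~ N w -> forall t b, (K <= t <= T)%N -> means F (emp_mean (hist t w) b)) ->
  (0 < k)%N ->
  exists B : nat -> \bar R, [/\ forall t, (0 <= B t)%E,
    (\sum_(t < T) B t <= (explore_cst * expR (- (k%:R * kap)))%:E)%E &
    forall t, (K <= t < T)%N ->
      (P ([set w | count t a1 w = k] `&` all_below t `&` pull t a) <= B t)%E].
Proof.
move=> mN PN regN k0.
have kR : 0 < k%:R :> R by rewrite ltr0n.
have c0 j : 0 <= d * j%:R / k%:R by rewrite divr_ge0// mulr_ge0// ltW.
(* At divergence [d * j / k] the sampling exponent [k / d * KLm F x y0] equals [j], and the Chernoff
   exponent is [d * j + k * kap]. *)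
have /choice[DC hDC] := fun j => kl_level (c0 j) k0.
pose D j := (DC j).1; pose C j := (DC j).2.
have kc j : k%:R * (d * j%:R / k%:R + kap) = d * j%:R + k%:R * kap.
  by rewrite mulrDr mulrC divfK ?gt_eqF.
have PC j : (P (C j) <= (expR (- (d * j%:R + k%:R * kap)))%:E)%E.
  by have [_ _ + _ _] := hDC j; rewrite kc.
have HD t j : HE t [set w | D j (emp_mean (hist t w) a1)].
  by have [mD _ _ _ _] := hDC j; exact: (history_events_emp_mean a1 mD).
have Hk t : HE t [set w | count t a1 w = k] by exact: history_events_count.
pose Hj j t := [set w | count t a1 w = k] `&` all_below t `&`
  ([set w | D j (emp_mean (hist t w) a1)] `\`
   [set w | D j.+1 (emp_mean (hist t w) a1)]).
pose G t := [set w | count t a1 w = k] `&` [set w | D T (emp_mean (hist t w) a1)].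
have HHj j t : HE t (Hj j t).
  apply: history_eventsI; last by apply: history_eventsD; exact: HD.
  by apply: history_eventsI; [exact: Hk|exact: history_events_all_below].
have HG t : HE t (G t) by apply: history_eventsI; [exact: Hk|exact: HD].
(* Below level [T], a pull of [a] is charged to a pull of [a1], of which there is at most one at
   count [k]; at level [T] the bare probability is small enough. *)
exists (fun t => \sum_(j < T) (expR (j.+1%:R))%:E * P (Hj j t `&` pull t a1) +
  P (G t))%E; split.
- by move=> t; apply: adde_ge0 => //; apply: sume_ge0 => j _; apply: mule_ge0.
- rewrite big_split/= exchange_big/=.
  have h1 (j : 'I_T) : (\sum_(t < T) (expR j.+1%:R)%:E * P (Hj j t `&` pull t a1) <=
     (expR 1 * expR (- (k%:R * kap)) * expR (- (d - 1)) ^+ j)%:E)%E.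
    rewrite -ge0_sume_distrr//.
    apply: (@le_trans _ _ ((expR j.+1%:R)%:E * P (C j))%E).
      apply: lee_pmul => //; first by apply: sume_ge0.
      apply: (sum_pull_le run (a := a1) (k := k)) => //.
      + by have [] := hDC j.
      + by move=> t w tT [[]].
      + move=> t w tT [[ck _] [Dj _]]; have [_ _ _ _] := hDC j.
        by apply; [exact: ltnW tT|exact: ck|].
    apply: (@le_trans _ _ ((expR j.+1%:R)%:E * (expR (- (d * j%:R + k%:R * kap)))%:E)%E).
      by apply: lee_pmul => //; exact: PC.
    rewrite -EFinM lee_fin -expRD -expRM_natl -!expRD ler_expR.
    by rewrite -natr1; move: (j%:R : R) (k%:R * kap) => J Q; lra.
  (* Each of the [T] rounds costs a factor [expR (- (d * T))], and [T <= expR T <= expR (d * T)]. *)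
  have h2 : (\sum_(t < T) P (G t) <= (expR (- (k%:R * kap)))%:E)%E.
    apply: (@le_trans _ _ (\sum_(t < T) (expR (- (d * T%:R + k%:R * kap)))%:E)%E).
      apply: lee_sum => t _; apply: le_trans (PC T).
      apply: le_measure; rewrite ?inE.
      - by apply: (history_events_measurable run (ltnW (ltn_ord t))).
      - by have [] := hDC T.
      move=> w [ck Dw]; have [_ _ _ _] := hDC T.
      by apply; [exact: ltnW (ltn_ord t)|exact: ck|].
    rewrite sumEFin lee_fin sumr_const card_ord -[leLHS]mulr_natl opprD expRD mulrA.
    rewrite ler_piMl ?expR_ge0// expRN ler_pdivrMr ?expR_gt0// mul1r.
    apply: (@le_trans _ _ (expR T%:R)).
      by apply: le_trans (expR_ge1Dx _); rewrite lerDr.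
    by rewrite ler_expR ler_peMl// ltW.
  apply: (@le_trans _ _ (\sum_(j < T) (expR 1 * expR (- (k%:R * kap)) *
       expR (- (d - 1)) ^+ j)%:E + (expR (- (k%:R * kap)))%:E)%E).
    by apply: leeD => //; apply: lee_sum.
  rewrite sumEFin -EFinD lee_fin -mulr_sumr.
  set E := expR (- (k%:R * kap)).
  rewrite /explore_cst mulrDl mul1r lerD2r [leLHS]mulrAC.
  rewrite ler_wpM2r ?expR_ge0// ler_wpM2l ?expR_ge0//.
  apply: sum_geometric_le; rewrite expR_ge0/=.
  by rewrite -[ltRHS]expR0 ltr_expR oppr_lt0 subr_gt0.
- move=> t /andP[Kt tT].
  have mA b (H : set Omega) : HE t H -> measurable (H `&` pull t b).
    exact: (history_pull_measurable run b tT).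
  pose B j := if (j < T)%N then Hj j t `&` pull t a else G t.
  have mG : measurable (G t) by exact: (history_events_measurable run (ltnW tT) (HG t)).
  apply: (@le_trans _ _ (\sum_(j < T.+1) P (B j))%E).
    apply: (measure_cover_null _ mN PN).
    - by apply: mA; apply: history_eventsI; [exact: Hk|exact: history_events_all_below].
    - by move=> j _; rewrite /B; case: ifP => _; [exact: mA|exact: mG].
    move=> w [[/= ck wb] Ia] nN; set x := emp_mean (hist t w) a1.
    have mx : means F x by apply: regN => //; rewrite Kt ltnW.
    have [DT|nDT] := pselect (D T x).
      by exists T => //; rewrite /B ltnn.
    have D0 : D 0%N x.
      have [_ _ _ hD _] := hDC 0%N; apply/(hD x mx (wb a1)).
      by rewrite mulr0 mul0r (KLm_ge0 geo).
    (* Level 0 is always reached and level [T] is not, so some level [j] is the last one before a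
       failure. *)
    have [j jT [Dj nDj]] : exists2 j, (j < T)%N & D j x /\ ~ D j.+1 x.
      elim: T nDT => [//|n IHn nDn]; have [Dn|/IHn[j jn h]] := pselect (D n x).
        by exists n.
      by exists j => //; exact: ltnW.
    by exists j; [exact: ltnW|rewrite /B jT; split].
  rewrite big_ord_recr/= {2}/B ltnn; apply: leeD => //; apply: lee_sum => j _.
  rewrite /B ltn_ord.
  apply: (run_arm_compare run tT (HHj j t) _ mN PN); first exact: expR_gt0.
    by move=> h b; exact: kl_ms_ge0.
  move=> w [[/= ck wb] [Dj nDj]] nN.
  have Kh : (K <= size (hist t w))%N by rewrite size_history.
  have mF b : means F (emp_mean (hist t w) b) by apply: regN => //; rewrite Kt ltnW.
  apply: (le_trans (kl_ms_ratio a a1 Kh mF)); rewrite ler_wpM2r ?kl_ms_ge0//.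
  rewrite /kl_weight -expRN opprK ler_expR -/(arm_count I r t a1 w) ck.
  set x := emp_mean (hist t w) a1 in Dj nDj *.
  have [b bE] := emp_max_attained (hist t w).
  have mmax : means F (emp_max (hist t w)) by rewrite bE; exact: mF.
  have xmax : x <= emp_max (hist t w) <= y0.
    by rewrite emp_mean_le_max/= bE ltW//; exact: wb.
  have [_ _ _ hD _] := hDC j.+1.
  have {nDj}: KLm F x y0 < d * j.+1%:R / k%:R.
    by rewrite ltNge; apply/negP => h; apply: nDj; apply/(hD x (mF a1) (wb a1)).
  (* Since the empirical maximum lies between [x] and [y0], the divergence of [x] from it is at most
     that from [y0]; hence the weight of [a1] is at least [expR (- (j + 1))]. *)
  have := KLm_superadd_le geo (mF a1) mmax my0 xmax; have := KLm_ge0 geo mmax my0.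
  rewrite -/x => h1 h2 /ltW h3.
  apply: (@le_trans _ _ (k%:R / d * (d * j.+1%:R / k%:R))).
    rewrite ler_wpM2l ?divr_ge0 ?(ltW d0)//.
    by apply: le_trans h3; apply: le_trans h2; rewrite lerDl.
  by rewrite (_ : _ * _ = j.+1%:R)//; field; rewrite !gt_eqF.
Qed.

(** One term per case: at most [u] previous pulls; empirical mean of [a] at least [x2]; empirical
    mean at most [x2] with the largest one at least [y0]; all empirical means below [y0]. *)
Lemma expected_pulls_le u :
  (\sum_(t < T) P (pull t a) <= (u.+1%:R + kap^-1 +
    T%:R * expR (- (u%:R / d * kap)) + explore_cst * kap^-1)%:E)%E.
Proof.
have [N [mN PN hN]] := regular_runs.
have count_gt0 w : ~ N w -> forall t b, (K <= t <= T)%N -> (0 < count t b w)%N.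
  move=> nN t b /andP[Kt tT]; have [_ h] := hN w nN.
  apply: leq_trans (arm_count_homo I r b w Kt).
  by rewrite (h K b) ?ltn_ord// (leq_trans Kt).
have regN w : ~ N w -> forall t b, (K <= t <= T)%N -> means F (emp_mean (hist t w) b).
  move=> nN t b KtT; have [h _] := hN w nN; apply: h; last exact: count_gt0.
  by case/andP: KtT => Kt ->; rewrite (leq_trans K0).
pose c3 := expR (- (u%:R / d * kap)).
(* [B k] concerns [k + 1] pulls of [a1]: after the first [K] rounds every count is positive. *)
have /choice[B hB] := fun k => exploration_level mN PN regN (ltn0Sn k).
pose H1 k t := [set w | count t a w = k].
pose H2 k t := [set w | count t a w = k] `&` [set w | x2 <= emp_mean (hist t w) a].
have HH1 k t : HE t (H1 k t) by exact: history_events_count.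
have Hge t : HE t [set w | x2 <= emp_mean (hist t w) a].
  have := history_events_emp_mean (I := I) (r := r) (t := t) a
    (measurable_itv `[(x2 : R), +oo[).
  by rewrite set_itvE.
have Hle t : HE t [set w | emp_mean (hist t w) a <= x2].
  have := history_events_emp_mean (I := I) (r := r) (t := t) a
    (measurable_itv `]-oo, (x2 : R)]).
  by rewrite set_itvE.
have HH2 k t : HE t (H2 k t) by apply: history_eventsI; [exact: HH1|exact: Hge].
pose H3 t := [set w | emp_mean (hist t w) a <= x2] `\` [set w | (count t a w < u.+1)%N]
  `\` all_below t.
have HH3 t : HE t (H3 t).
  apply: history_eventsD; last exact: history_events_all_below.
  by apply: history_eventsD; [exact: Hle|exact: history_events_count_lt].
have mA t b (H : set Omega) : (t < T)%N -> HE t H -> measurable (H `&` pull t b).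
  by move=> tT; exact: (history_pull_measurable run b tT).
have P3 t : (K <= t < T)%N -> (P (H3 t `&` pull t a) <= c3%:E)%E.
  move=> /andP[Kt tT]; apply: (run_arm_le run tT (HH3 t) (expR_gt0 _) mN PN).
    by move=> h b; exact: kl_ms_ge0.
  move=> w [[/= ex2 cu] nb] nN.
  have Kh : (K <= size (hist t w))%N by rewrite size_history.
  have mF b : means F (emp_mean (hist t w) b) by apply: regN => //; rewrite Kt ltnW.
  apply: (le_trans (kl_ms_le a Kh mF)); rewrite ler_expR lerN2 -/(arm_count I r t a w).
  have [b bE] := emp_max_attained (hist t w).
  have mmax : means F (emp_max (hist t w)) by rewrite bE; exact: mF.
  have ymax : y0 <= emp_max (hist t w).
    rewrite leNgt; apply/negP => my; apply: nb => c.
    by apply: le_lt_trans my; exact: emp_mean_le_max.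
  have uc : (u <= count t a w)%N by rewrite leqNgt; apply/negP => h; apply: cu; exact: ltnW.
  rewrite -!mulrA ler_pM ?mulr_ge0 ?invr_ge0 ?(ltW d0) ?(ltW kap0) ?ler_nat//.
  rewrite ler_wpM2l ?invr_ge0 ?(ltW d0)//; apply: (le_trans kap1).
  (* Along the chain from the empirical mean of [a] through [x2] and [y0] to the empirical maximum,
     superadditivity leaves at least [KLm F x2 y0]. *)
  have h1 := KLm_superadd_le geo (mF a) mx2 mmax.
  have h2 := KLm_superadd_le geo mx2 my0 mmax.
  have g1 := KLm_ge0 geo (mF a) mx2; have g2 := KLm_ge0 geo my0 mmax.
  apply: le_trans (h1 _); last by rewrite ex2 (le_trans (ltW x2y0)).
  apply: (@le_trans _ _ (KLm F x2 (emp_max (hist t w)))); last by rewrite lerDr.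
  by apply: le_trans (h2 _); [rewrite lerDl|rewrite (ltW x2y0)].
pose bound t := (\sum_(k < u.+1) P (H1 k t `&` pull t a) +
    (\sum_(k < T) P (H2 k.+1 t `&` pull t a) + (c3%:E + \sum_(k < T) B k t)))%E.
have step t : (t < T)%N -> (P (pull t a) <= bound t)%E.
  rewrite /bound => tT; have mp := measurable_pull run a tT.
  have S1ge0 : (0 <= \sum_(k < T) P (H2 k.+1 t `&` pull t a))%E by exact: sume_ge0.
  have S2ge0 : (0 <= \sum_(k < T) B k t)%E.
    by apply: sume_ge0 => k _; have [] := hB k.
  (* In the initial rounds a pull of [a] is its first one, so the term [k = 0] of the first sum
     already covers it. *)
  have [tK|Kt] := ltnP t K.
    apply: (@le_trans _ _ (\sum_(k < u.+1) P (H1 k t `&` pull t a))%E).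
      apply: (measure_cover_null (B := fun k => H1 k t `&` pull t a) mp mN PN).
        by move=> k _; exact: mA.
      move=> w Ia nN; exists 0%N => //; split => //.
      have [_ h] := hN w nN; have := h t.+1 a tT tK.
      rewrite /H1/= arm_countS Ia eqxx (h t a (ltnW tT) (ltnW tK)) addn1.
      by case: (a < t)%N => //; case: (a < t.+1)%N.
    by rewrite leeDl//; apply: adde_ge0 => //; apply: adde_ge0; rewrite ?lee_fin ?expR_ge0.
  have KtT : (K <= t < T)%N by rewrite Kt.
  have KtT' : (K <= t <= T)%N by rewrite Kt ltnW.
  pose S := [:: [set w | (count t a w < u.+1)%N] `&` pull t a;
     [set w | x2 <= emp_mean (hist t w) a] `&` pull t a;
     H3 t `&` pull t a; all_below t `&` pull t a].
  have mS i : measurable (nth set0 S i).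
    case: i => [|[|[|[|i]]]] /=; try by apply: mA => //; exact: history_events_count_lt.
    + by apply: mA => //; exact: history_events_all_below.
    + by rewrite nth_nil.
  apply: (@le_trans _ _ (\sum_(i < 4) P (nth set0 S i))%E).
    apply: (measure_cover_null mp mN PN) => // w Ia nN.
    have [cu|cu] := ltnP (count t a w) u.+1; first by exists 0%N.
    have [xe|ex] := lerP x2 (emp_mean (hist t w) a); first by exists 1%N.
    have [wb|nb] := pselect (all_below t w); first by exists 3%N.
    exists 2%N => //; split => //; split => //; split; first exact: ltW.
    by move=> /= h; move: cu; rewrite leqNgt h.
  have -> : (\sum_(i < 4) P (nth set0 S i) = P (nth set0 S 0) + (P (nth set0 S 1) +
      (P (nth set0 S 2) + P (nth set0 S 3))))%E.
    by rewrite !big_ord_recl big_ord0 adde0.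
  apply: leeD; last apply: leeD; last apply: leeD.
  - apply: (measure_cover_null (B := fun k => H1 k t `&` pull t a) (mS 0%N) mN PN).
      by move=> k _; exact: mA.
    by move=> w [/= cu Ia] _; exists (count t a w).
  - apply: (measure_cover_null (B := fun k => H2 k.+1 t `&` pull t a) (mS 1%N) mN PN).
      by move=> k _; exact: mA.
    move=> w [/= xe Ia] nN; have c0 := count_gt0 w nN t a KtT'.
    exists (count t a w).-1; last by split => //; split; rewrite //= prednK.
    by rewrite prednK// (leq_trans (arm_count_le I r t a w))// ltnW.
  - exact: P3.
  - apply: (@le_trans _ _ (\sum_(k < T) P ([set w | count t a1 w = k.+1] `&`
        all_below t `&` pull t a))%E); last first.
      by apply: lee_sum => k _; have [_ _] := hB k; apply.
    apply: (measure_cover_null (B := fun k => [set w | count t a1 w = k.+1] `&`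
        all_below t `&` pull t a) (mS 3%N) mN PN).
      move=> k _; apply: mA => //; apply: history_eventsI; first exact: history_events_count.
      exact: history_events_all_below.
    move=> w [/= wb Ia] nN; have c0 := count_gt0 w nN t a1 KtT'.
    exists (count t a1 w).-1; last by split => //; split; rewrite //= prednK.
    by rewrite prednK// (leq_trans (arm_count_le I r t a1 w))// ltnW.
apply: (@le_trans _ _ (\sum_(t < T) bound t)%E).
  by apply: lee_sum => t _; exact: step.
(* Summing over the rounds first, at a fixed count, lets each count contribute a single event. *)
rewrite /bound !big_split/= exchange_big/= [X in (_ + (X + _))%E]exchange_big/=.
rewrite [X in (_ + (_ + (_ + X)))%E]exchange_big/=.
rewrite -!addrA !EFinD; apply: leeD; last apply: leeD; last apply: leeD.
- apply: (@le_trans _ _ (\sum_(k < u.+1) 1)%E); last first.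
    by rewrite sumEFin lee_fin sumr_const card_ord.
  apply: lee_sum => k _; rewrite -(probability_setT P).
  by apply: (sum_pull_le run (a := a) (k := k) (H := H1 k)).
- apply: (@le_trans _ _ (\sum_(k < T) (expR (- (k.+1%:R * kap)))%:E)%E); last first.
    by rewrite sumEFin lee_fin sum_expR_le.
  apply: lee_sum => k _.
  have [C mC [PC hC]] := chernoff_emp_mean a mx2 (ltn0Sn k).
  apply: (@le_trans _ _ (P C)).
    apply: (sum_pull_le run (a := a) (k := k.+1) (H := H2 k.+1)) => //.
    + by move=> t w tT [].
    + move=> t w tT [/= ck xe]; apply: (hC t w (ltnW tT) ck).
      by rewrite ax2 xe orbT.
  by apply: (le_trans PC); rewrite lee_fin ler_expR lerN2 ler_wpM2l.
- by rewrite sumEFin lee_fin sumr_const card_ord mulr_natl.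
- apply: (@le_trans _ _ (\sum_(k < T) (explore_cst * expR (- (k.+1%:R * kap)))%:E)%E).
    by apply: lee_sum => k _; have [_ + _] := hB k.
  rewrite sumEFin lee_fin -mulr_sumr ler_wpM2l ?(ltW explore_cst_gt0)//.
  exact: sum_expR_le.
Qed.

(** Balances [u] against [T * expR (- (u / d * kap))]. The maximum with [expR 1] makes the logarithm
    at least 1, so that it absorbs the terms of order [1 / kap]. *)
Lemma expected_pulls_log_le :
  (\sum_(t < T) P (pull t a) <= (2 + (d + 2 + explore_cst) *
    ln (Num.max (T%:R * kap) (expR 1)) / kap)%:E)%E.
Proof.
set L := ln _; have e0 := expR_gt0 (1 : R).
have m0 : 0 < Num.max (T%:R * kap) (expR 1) by rewrite lt_max e0 orbT.
have L1 : 1 <= L.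
  by rewrite -[leLHS](expRK 1) /L ler_ln ?posrE// le_max lexx orbT.
have L0 : 0 <= L by exact: le_trans L1.
have x0 : 0 <= d * L / kap by rewrite divr_ge0 ?mulr_ge0 ?(ltW d0) ?(ltW kap0).
(* Just above [d * L / kap], so the exponential is at most [expR (- L) <= 1 / (T * kap)]. *)
pose u := (Num.truncn (d * L / kap)).+1.
have /andP[u1 u2] := truncn_itv x0.
apply: (le_trans (expected_pulls_le u)); rewrite lee_fin.
have h1 : T%:R * expR (- (u%:R / d * kap)) <= kap^-1.
  apply: (@le_trans _ _ (T%:R * expR (- L))).
    rewrite ler_wpM2l// ler_expR lerN2.
    have := ltW u2; rewrite -/u ler_pdivrMr// => h.
    by rewrite mulrAC ler_pdivlMr// mulrC.
  rewrite expRN /L lnK ?posrE// -[leRHS]div1r ler_pdivlMr// mulrAC ler_pdivrMr// mul1r.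
  by rewrite le_max lexx.
have h2 : kap^-1 <= L / kap by rewrite ler_peMl// invr_ge0 ltW.
have h3 : explore_cst * kap^-1 <= explore_cst * (L / kap).
  by rewrite ler_wpM2l// ltW// explore_cst_gt0.
have h4 : u.+1%:R <= 2 + d * L / kap.
  by rewrite /u -natr1 -natr1; move: u1; set z := _%:R; lra.
rewrite (_ : (d + 2 + explore_cst) * L / kap =
  d * L / kap + 2 * (L / kap) + explore_cst * (L / kap)); last by ring.
have sum4 (p q s t v x y : R) : p <= q -> q <= x -> s <= y -> t <= 2 + v ->
    t + q + p + s <= 2 + (v + 2 * x + y) by lra.
exact: sum4.
Qed.

End arm_bound.

End kl_maillard.

(** * Summation over the arms *)

Section arithmetic.
Variable R : realType.
Implicit Types (d A C V D M T K S n : R).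

Lemma ln_le_sub1 (x : R) : 0 < x -> ln x <= x - 1.
Proof. by move=> x0; have := expR_ge1Dx (ln x); rewrite lnK ?posrE// lerBrDl. Qed.

(** For [0 < D <= M] one has [D ^+ 2 / (18 * (V + C * D)) <= M / (18 * C)]; so this bounds what the
    logarithm in the pull count adds to [ln T], uniformly in the gap and in [V]. *)
Definition log_cst C M : R := ln (Num.max (M / (18 * C)) (expR 1)).

Lemma log_cst_ge1 C M : 1 <= log_cst C M.
Proof.
rewrite /log_cst -[leLHS](expRK 1) ler_ln ?posrE ?expR_gt0//.
  by rewrite le_max lexx orbT.
by rewrite lt_max expR_gt0 orbT.
Qed.

Definition log_coef A C M : R :=
  2 * M / ln 2 + 18 * A * C * (1 + log_cst C M / ln 2).

Definition sqrt_coef A : R := 36 * A * (1 + 1 / ln 2).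

(** Expanding [1 / kap] splits the bound into [2 * D], [18 * A * C * L] and [18 * A * V * L / D].
    The first two are of order [ln T], as [ln T >= ln 2]. For the third, the large gap [D > S / T]
    allows [L] to be compared with [ln K] instead of [ln T]. *)
Lemma arm_regret_le A C V M D T K S n : 0 < A -> 0 < C -> 0 <= V ->
  0 < D <= M -> 2 <= T -> 2 <= K -> 0 <= S -> S ^+ 2 = V * K * T * ln K ->
  S < T * D ->
  let kap := D ^+ 2 / (18 * (V + C * D)) in
  n <= 2 + A * ln (Num.max (T * kap) (expR 1)) / kap ->
  D * n <= log_coef A C M * ln T + sqrt_coef A * (S / K).
Proof.
move=> A0 C0 V0 /andP[D0 DM] T2 K2 S0 S2 SD kap hn.
have T0 : 0 < T by apply: lt_le_trans T2.
have K0 : 0 < K by apply: lt_le_trans K2.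
have T1 : 1 <= T by apply: le_trans T2; rewrite ler1n.
have K1 : 1 <= K by apply: le_trans K2; rewrite ler1n.
have CD0 : 0 < C * D by exact: mulr_gt0.
have VCD0 : 0 < V + C * D by rewrite ltr_wpDl.
have kap0 : 0 < kap by rewrite divr_gt0 ?exprn_gt0// mulr_gt0.
have l2 : 0 < ln 2 :> R by rewrite ln_gt0// ltr1n.
have lT : ln 2 <= ln T by rewrite ler_ln ?posrE.
have lK : ln 2 <= ln K by rewrite ler_ln ?posrE.
have lT0 : 0 < ln T := lt_le_trans l2 lT.
have lK0 : 0 < ln K := lt_le_trans l2 lK.
set L := ln (Num.max _ _) in hn.
have e0 := expR_gt0 (1 : R).
have m0 x : 0 < Num.max x (expR 1 : R) by rewrite lt_max e0 orbT.
have l0 := log_cst_ge1 C M.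
have M0 : 0 < M := lt_le_trans D0 DM.
have L1 : L <= (1 + log_cst C M / ln 2) * ln T.
  have : L <= ln T + log_cst C M.
    rewrite /L /log_cst -lnM ?posrE// ler_ln ?posrE ?mulr_gt0//.
    rewrite maxr_pMr ?(ltW T0)// ge_max; apply/andP; split.
      rewrite le_max ler_pM2l//; apply/orP; left.
      rewrite /kap ler_pdivrMr ?mulr_gt0// mulrAC ler_pdivlMr ?mulr_gt0//.
      have h1 : D ^+ 2 * C <= M * (C * D).
        by rewrite (_ : D ^+ 2 * C = D * (C * D)) ?ler_pM2r//; ring.
      have h2 : M * (C * D) <= M * (V + C * D) by rewrite ler_pM2l// lerDr.
      have := le_trans h1 h2; set X := D ^+ 2 * C; set Y := M * (V + C * D) => h.
      rewrite (_ : D ^+ 2 * (18 * C) = 18 * X); last by rewrite /X; ring.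
      rewrite (_ : M * (18 * (V + C * D)) = 18 * Y); last by rewrite /Y; ring.
      by rewrite ler_pM2l.
    by rewrite le_max (ler_peMl (ltW e0) T1) orbT.
  move=> h; apply: (le_trans h); rewrite mulrDl mul1r lerD2l.
  rewrite mulrAC -mulrA ler_peMr ?(le_trans ler01)//.
  by rewrite ler_pdivlMr// mul1r.
have DnE : D * n <= 2 * M + 18 * A * C * L + 18 * A * (V * L / D).
  apply: (@le_trans _ _ (D * (2 + A * L / kap))); first by rewrite ler_pM2l.
  rewrite (_ : D * (2 + A * L / kap) = 2 * D + 18 * A * C * L + 18 * A * (V * L / D)).
    by rewrite -!addrA lerD2r ler_pM2l.
  rewrite /kap; field.
  by rewrite !gt_eqF.
have VL : V * L / D <= 2 * (1 + 1 / ln 2) * (S / K).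
  (* If [V = 0] then [S = 0], and the ratio [T * D / S] below would be meaningless. *)
  have [V00|V00] := eqVneq V 0.
    have l2i : 0 <= 1 / ln 2 :> R by rewrite divr_ge0// ltW.
    by rewrite V00 !mul0r !mulr_ge0 ?addr_ge0 ?invr_ge0 ?(ltW K0).
  have {V00}V0 : 0 < V by rewrite lt_neqAle eq_sym V00.
  have Sp : 0 < S.
    rewrite lt_neqAle S0 andbT eq_sym -sqrf_eq0 S2.
    by rewrite !mulf_neq0 ?gt_eqF.
  (* The gap in units of the threshold [S / T]; [L] is at most linear in [y] plus [2 * ln K], and
     dividing by [y >= 1] removes the dependence on the gap. *)
  pose y := T * D / S.
  have y1 : 1 <= y by rewrite ler_pdivlMr// mul1r ltW.
  have y0 : 0 < y := lt_le_trans ltr01 y1.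
  have Ly : L <= 1 + 2 * (y - 1) + 2 * ln K.
    have L2 : L <= ln (expR 1 * y ^+ 2 * K ^+ 2).
      have rhs0 := mulr_gt0 (mulr_gt0 e0 (exprn_gt0 2 y0)) (exprn_gt0 2 K0).
      rewrite /L ler_ln ?posrE// ge_max; apply/andP; split.
        apply: (@le_trans _ _ (y ^+ 2 * K ^+ 2)); last first.
          have e1 : 1 <= expR 1 :> R by rewrite -[leLHS]expR0 ler_expR.
          rewrite -mulrA (ler_peMl _ e1)//.
          exact: mulr_ge0 (exprn_ge0 2 (ltW y0)) (exprn_ge0 2 (ltW K0)).
        (* By the choice of [S], [T * D ^+ 2 / V = y ^+ 2 * K * ln K], and [ln K <= K]. *)
        apply: (@le_trans _ _ (T * D ^+ 2 / V)).
          rewrite /kap mulrA ler_pM2l ?mulr_gt0 ?exprn_gt0// lef_pV2 ?posrE ?mulr_gt0//.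
          have := ltW CD0; move: (C * D) => z z0; lra.
        rewrite ler_pdivrMr// /y expr_div_n S2.
        rewrite (_ : _ * V = T * D ^+ 2 * (K / ln K)); last by field; rewrite !gt_eqF.
        have lnKK : 1 <= K / ln K.
          by rewrite ler_pdivlMr// mul1r (le_trans (ln_le_sub1 K0))// gerBl.
        exact: (ler_peMr (mulr_ge0 (ltW T0) (exprn_ge0 2 (ltW D0))) lnKK).
      rewrite -mulrA ler_peMr ?expR_ge0// -exprMn exprn_ege1//.
      by rewrite mulr_ege1.
    apply: (le_trans L2); rewrite lnM ?posrE; last 2 first.
    - exact: mulr_gt0 e0 (exprn_gt0 2 y0).
    - exact: exprn_gt0.
    rewrite lnM ?posrE ?exprn_gt0// expRK !lnXn// -[ln y *+ 2]mulr_natl -[ln K *+ 2]mulr_natl.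
    by rewrite lerD2r lerD2l ler_pM2l// ln_le_sub1.
  have Ly2 : L / y <= 2 * (1 + 1 / ln 2) * ln K.
    rewrite ler_pdivrMr//; apply: (le_trans Ly).
    have lK1 : 1 <= 1 / ln 2 * ln K by rewrite mul1r mulrC ler_pdivlMr// mul1r.
    have h1 : ln K <= y * ln K by rewrite ler_peMl// ltW.
    have h2 : y <= y * (1 / ln 2 * ln K) by rewrite ler_peMr// ltW.
    rewrite (_ : 2 * (1 + 1 / ln 2) * ln K * y = 2 * (y * ln K) + 2 * (y * (1 / ln 2 * ln K))).
      move: h1 h2; move: (y * ln K) (y * (1 / ln 2 * ln K)) (ln K) => p q v; clear; lra.
    by field; rewrite gt_eqF.
  (* Substituting [V = S ^+ 2 / (K * T * ln K)] turns [V / D] into [S / (y * K * ln K)], whose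
     [ln K] cancels the one bounding [L / y]. *)
  rewrite (_ : V * L / D = (L / y) * (S / K / ln K)); last first.
    rewrite (_ : V = S ^+ 2 / (K * T * ln K)); last by rewrite S2; field; rewrite !gt_eqF.
    by rewrite /y; field; rewrite !gt_eqF.
  apply: le_trans (ler_wpM2r _ Ly2) _; first by rewrite !divr_ge0// ltW.
  rewrite le_eqVlt; apply/orP; left; apply/eqP; field; by rewrite !gt_eqF.
apply: (le_trans DnE); apply: lerD.
  rewrite /log_coef [leRHS]mulrDl; apply: lerD.
    rewrite -[leRHS]mulrA ler_peMr//; first by rewrite mulr_ge0// ltW.
    by rewrite mulrC ler_pdivlMr// mul1r.
  by rewrite -[leRHS]mulrA ler_pM2l ?mulr_gt0.
rewrite /sqrt_coef (_ : 36 * A * _ * _ = 18 * A * (2 * (1 + 1 / ln 2) * (S / K))).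
  by rewrite ler_pM2l ?mulr_gt0.
by move: (S / K) (1 / ln 2) => p q; ring.
Qed.

End arithmetic.

Lemma var_ge0 (R : realType) (Q : law R) : 0 <= var Q.
Proof. by rewrite fine_ge0// variance_ge0. Qed.

Theorem corollary10 (R : realType) (d C_L M : R)
    (hd : 1 < d) (hCL : 0 < C_L) (hM : 0 < M) :
  exists2 C : R, 0 < C &
    forall (m : {measure set (measurableTypeR R) -> \bar R}) (Theta : set R),
      let F := expfam m Theta in
      let FM := mean_bounded F M in
      let V := variance_function F in
      regular_expfam m Theta ->
      (forall mu mu' : R, means FM mu -> means FM mu' ->
         `|V mu - V mu'| <= C_L * `|mu - mu'|) ->
    forall (K T : nat), (2 <= K)%N -> (2 <= T)%N ->
    forall (disp : measure_display) (Omega : measurableType disp)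
      (P : probability Omega R) (nu : 'I_K -> law R)
      (I : nat -> Omega -> 'I_K) (r : nat -> Omega -> R),
      (forall a, FM (nu a)) ->
      bandit_run P nu T I r
        (@general_exp_kl_ms R K F (fun k : nat => k%:R / d)) ->
      emp_means_in P T I r F ->
      (regret P nu T I <=
        (C * Num.sqrt (V (mu_max nu) * K%:R * T%:R * ln K%:R)
         + C * K%:R * ln T%:R)%:E)%E.
Proof.
pose A := d + 2 + explore_cst d.
have A0 : 0 < A.
  by rewrite addr_gt0 ?explore_cst_gt0// addr_gt0// (lt_trans ltr01 hd).
have l2 : 0 < ln 2 :> R by rewrite ln_gt0// ltr1n.
have lc0 : 0 < log_coef A C_L M.
  have l0 := log_cst_ge1 C_L M.
  rewrite ltr_wpDl ?divr_ge0 ?mulr_ge0 ?ltW// !mulr_gt0// ltr_pwDl// divr_ge0 ?ltW//.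
  exact: lt_le_trans l0.
have sc0 : 0 < sqrt_coef A.
  by rewrite !mulr_gt0// addr_gt0// divr_gt0.
(* The extra 1 pays for the arms with gap at most [S / T]. *)
exists (log_coef A C_L M + (sqrt_coef A + 1)).
  exact: (addr_gt0 lc0 (addr_gt0 sc0 ltr01)).
move=> m Theta F FM V reg lipV K T K2 T2 disp Omega P nu I r FMnu run emp.
have K0 : (0 < K)%N by exact: ltnW.
have T0 : (0 < T)%N by exact: ltnW.
have Fnu a : F (nu a) by have [] := FMnu a.
have [a1 mumaxE] := sup_range_attained (fun a => mean (nu a)) K0.
rewrite -/(mu_max nu) in mumaxE.
have le_mumax a : mean (nu a) <= mu_max nu by exact: (le_sup_range (fun b => mean (nu b))).
set S := Num.sqrt _.
have KR2 : 2 <= K%:R :> R by rewrite ler_nat.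
have TR2 : 2 <= T%:R :> R by rewrite ler_nat.
have KR0 : 0 < K%:R :> R by rewrite ltr0n.
have TR0 : 0 < T%:R :> R by rewrite ltr0n.
have lK0 : 0 < ln K%:R :> R by rewrite ln_gt0// ltr1n.
have lT0 : 0 < ln T%:R :> R by rewrite ln_gt0// ltr1n.
have V0 : 0 <= V (mu_max nu) by exact: var_ge0.
have S0 : 0 <= S by exact: sqrtr_ge0.
have S2 : S ^+ 2 = V (mu_max nu) * K%:R * T%:R * ln K%:R.
  by rewrite sqr_sqrtr// !mulr_ge0 ?ler0n ?(ltW lK0).
have SK0 : 0 <= S / K%:R := divr_ge0 S0 (ltW KR0).
have ST0 : 0 <= S / T%:R := divr_ge0 S0 (ltW TR0).
pose N a : \bar R := (\sum_(t < T) P (I t.+1 @^-1` [set a]))%E.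
have Nfin a : N a \is a fin_num.
  apply/sum_fin_numP => t _ _; apply: fin_num_measure.
  exact: (measurable_pull run a (ltn_ord t)).
have N0 a : 0 <= fine (N a) by rewrite fine_ge0// sume_ge0.
have arm a : (mu_max nu - mean (nu a)) * fine (N a) <=
    log_coef A C_L M * ln T%:R + sqrt_coef A * (S / K%:R) + S / T%:R * fine (N a).
  set D := mu_max nu - mean (nu a).
  have [Dsmall|Dlarge] := leP D (S / T%:R).
    apply: (@le_trans _ _ (S / T%:R * fine (N a))); first by rewrite ler_wpM2r.
    by rewrite lerDr (addr_ge0 (mulr_ge0 (ltW lc0) (ltW lT0)) (mulr_ge0 (ltW sc0) SK0)).
  apply: (@le_trans _ _ (log_coef A C_L M * ln T%:R + sqrt_coef A * (S / K%:R))); last first.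
    by rewrite lerDl mulr_ge0.
  have D0 : 0 < D by exact: le_lt_trans Dlarge.
  have amax : mean (nu a) < mu_max nu by rewrite -subr_gt0.
  (* The positive gap provides the two distinct means; if all gaps vanish, this branch is never
     entered. *)
  have geo : kl_geometry F.
    apply: (expfam_kl_geometry reg (Fnu a) (Fnu a1)).
    by rewrite -mumaxE lt_eqF.
  have [_ /andP[mua0 _]] := FMnu a; have [_ /andP[_ mumaxM]] := FMnu a1.
  rewrite -mumaxE in mumaxM.
  have DM : D <= M by rewrite lerBlDr (le_trans mumaxM)// lerDl ltW.
  have mF b : means F (mean (nu b)) by exact: means_nu.
  have mmax : means F (mu_max nu) by rewrite mumaxE.
  pose DV := V (mu_max nu) + C_L * D.
  have DV0 : 0 < DV by rewrite ltr_wpDl// mulr_gt0.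
  (* The Lipschitz hypothesis speaks of means in [(0, M]]; all means between that of [a] and
     [mu_max] are such, the means forming an interval. *)
  have mFM mu : mean (nu a) < mu <= mu_max nu -> means FM mu.
    move=> /andP[amu mumax].
    have [Q FQ QE] : means F mu.
      by apply: (means_itv geo (mF a) mmax); rewrite (ltW amu).
    by exists Q => //; split => //; rewrite QE (lt_trans mua0)// (le_trans mumax).
  have VDV mu : mean (nu a) < mu < mu_max nu -> V mu <= DV.
    move=> /andP[amu mumax].
    have m1 : means FM mu by apply: mFM; rewrite amu ltW.
    have m2 : means FM (mu_max nu) by apply: mFM; rewrite amax lexx.
    have := lipV mu (mu_max nu) m1 m2; rewrite ler_norml => /andP[_].
    rewrite lerBlDl => /le_trans; apply; rewrite lerD2l ler_pM2l//.
    by rewrite ler0_norm ?subr_le0 ?(ltW mumax)// opprB lerD2l lerN2 ltW.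
  pose x2 := mean (nu a) + D / 3; pose y0 := mean (nu a) + 2 * D / 3.
  have muE : mu_max nu = mean (nu a) + D by rewrite addrC subrK.
  (* Two points at distance [D / 3] have divergence at least [(D / 3) ^+ 2 / (2 * DV)], which is
     [kap]. *)
  pose kap := D ^+ 2 / (18 * DV).
  have DV18 : 0 < 18 * DV by rewrite mulr_gt0.
  have DV2 : 0 < 2 * DV by rewrite mulr_gt0.
  have kap0 : 0 < kap by rewrite divr_gt0 ?exprn_gt0// mulr_gt0.
  have D3 : 0 < D / 3 by rewrite divr_gt0.
  have x2lo : mean (nu a) <= x2 by rewrite lerDl ltW.
  have x2y0 : x2 < y0 by rewrite ltrD2l; lra.
  have y0hi : y0 <= mu_max nu by rewrite muE lerD2l; lra.
  have x2hi : x2 <= mu_max nu by exact: le_trans (ltW x2y0) y0hi.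
  have y0lo : mean (nu a) <= y0 by exact: le_trans x2lo (ltW x2y0).
  have mx2 : means F x2 by apply: (means_itv geo (mF a) mmax); rewrite x2lo.
  have my0 : means F y0 by apply: (means_itv geo (mF a) mmax); rewrite y0lo.
  have kapE x y : mean (nu a) <= x <= mu_max nu -> mean (nu a) <= y <= mu_max nu ->
      (y - x) ^+ 2 = D ^+ 2 / 9 -> kap <= KLm F x y.
    move=> xr yr xyE; have := KLm_quadratic geo (mF a) mmax VDV xr yr.
    rewrite xyE /kap ler_pdivrMr// ler_pdivrMr// => /le_trans; apply.
    by rewrite le_eqVlt; apply/orP; left; apply/eqP; ring.
  have kap1 : kap <= KLm F x2 y0.
    by apply: kapE; rewrite ?x2lo ?y0lo// /x2 /y0; field.
  have kap2 : kap <= KLm F x2 (mean (nu a)).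
    by apply: kapE; rewrite ?x2lo ?lexx ?(ltW amax)// /x2; field.
  have kap3 : kap <= KLm F y0 (mean (nu a1)).
    rewrite -mumaxE; apply: kapE; rewrite ?y0lo ?lexx ?(ltW amax)//.
    by rewrite muE /y0; field.
  have y0a1 : y0 <= mean (nu a1) by rewrite -mumaxE.
  have NA := expected_pulls_log_le hd K0 geo run emp Fnu mx2 my0 x2lo x2y0 y0a1
    kap0 kap1 kap2 kap3.
  apply: (arm_regret_le A0 hCL V0 _ TR2 KR2 S0 S2); first by rewrite D0.
    by rewrite mulrC -ltr_pdivrMr.
  by rewrite -lee_fin fineK.
rewrite (regretE run); apply: (@le_trans _ _ (\sum_a (log_coef A C_L M * ln T%:R +
    sqrt_coef A * (S / K%:R) + S / T%:R * fine (N a))%:E)%E).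
  apply: lee_sum => a _; rewrite -/(N a) -(fineK (Nfin a)) -EFinM lee_fin.
  exact: arm.
(* Over the [K] arms the terms in [S / K] add up to a multiple of [S]; those in [S / T] add up to at
   most [S], the total number of pulls being at most [T]. *)
rewrite sumEFin lee_fin big_split/= sumr_const card_ord -mulr_sumr.
have NT : \sum_a fine (N a) <= T%:R.
  rewrite -lee_fin -sumEFin; apply: le_trans (sum_pulls_le run).
  by apply: lee_sum => a _; rewrite fineK.
have ST : S / T%:R * \sum_a fine (N a) <= S.
  apply: (@le_trans _ _ (S / T%:R * T%:R)); last by rewrite divfK ?gt_eqF.
  by rewrite ler_wpM2l.
rewrite -[X in X + _ <= _]mulr_natl
  (_ : K%:R * _ = log_coef A C_L M * K%:R * ln T%:R + sqrt_coef A * S).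
  set C := _ + (_ + 1).
  have h1 : log_coef A C_L M * K%:R * ln T%:R <= C * K%:R * ln T%:R.
    by rewrite -!mulrA ler_wpM2r ?mulr_ge0 ?(ltW KR0) ?(ltW lT0)// lerDl ltW// addr_gt0.
  have h2 : sqrt_coef A * S + S <= C * S.
    by rewrite -{2}(mul1r S) -mulrDl ler_wpM2r// lerDr ltW.
  apply: le_trans (_ : _ <= C * K%:R * ln T%:R + (sqrt_coef A * S + S)) _.
    by rewrite -addrA lerD// lerD2l.
  by rewrite addrC lerD2r.
by field; rewrite gt_eqF.
Qed.
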